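(* Let $w$ be a monotonic weight on the unit disc $\mathbb{D}$ such that $0<w(0)<\infty$. (a) If $w\in B_p$ for some $1<p<\infty$, then $w\in B_q$ for some $1<q<p$. (b) If $w\in B_p$ for some $1\le p<\infty$, then $w^{1+\varepsilon}\in B_p$ for some $\varepsilon>0$.
   Context: $\mathbb{D}=\{z\in\mathbb{C}:|z|<1\}$ carries normalized area measure and $\mathbb{T}=\{|z|=1\}$ carries normalized arc length measure; $|\cdot|$ denotes these measures. $I\subset\mathbb{T}$ always means that $I$ is an interval (arc) of $\mathbb{T}$ of positive length, possibly all of $\mathbb{T}$. The Carleson square of $I$ is $Q_I=\{z\in\mathbb{D}\setminus\{0\}: z/|z|\in I,\ 1-|z|<|I|\}$. A weight on $\mathbb{D}$ is a measurable $w:\mathbb{D}\to[0,\infty]$ with $0<w<\infty$ a.e. For an integrable weight $w$ (the classes below consist of integrable weights only): - $w\in B_1$ if there is $C>0$ with $\frac1{|Q_I|}\int_{Q_I}w\le C\operatorname{ess\,inf}_{Q_I}w$ for all $I\subset\mathbb{T}$. - $w\in B_p$ ($1<p<\infty$) if there is $C>0$ with $\left(\frac1{|Q_I|}\int_{Q_I}w\right)\left(\frac1{|Q_I|}\int_{Q_I}w^{1-p'}\right)^{p-1}\le C$ for all $I\subset\mathbb{T}$, where $p'=p/(p-1)$. A weight $w$ is monotonic if it is radial, i.e. $w(z)=f(|z|)$ for all $z\in\mathbb{D}$ for some measurable $f:[0,1)\to[0,\infty]$, and $f$ is monotonic (weakly increasing or weakly decreasing). *)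

(* Defs.v *)
From mathcomp Require Import all_boot all_order all_algebra.
From mathcomp Require Import all_classical all_reals all_analysis.
From mathcomp Require Import measurable_realfun ess_sup_inf.

Set Implicit Arguments.
Unset Strict Implicit.
Unset Printing Implicit Defensive.

Import Order.TTheory GRing.Theory Num.Theory.
Import numFieldNormedType.Exports.

Local Open Scope classical_set_scope.
Local Open Scope ring_scope.

(* The complex plane is represented by R * R, z = z.1 + i z.2, with its product
   sigma-algebra. The library norm on a product is the max norm, hence [cmod]. *)
Notation plane R := (measurableTypeR R * measurableTypeR R)%type.

Definition cmod (R : realType) (z : plane R) : R :=
  Num.sqrt (z.1 ^+ 2 + z.2 ^+ 2).

Definition origin (R : realType) : plane R := (0, 0).

Definition disc (R : realType) : set (plane R) := [set z | cmod z < 1].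

Definition expi (R : realType) (t : R) : plane R := (cos t, sin t).

(* z / |z| *)
Definition cdir (R : realType) (z : plane R) : plane R :=
  (z.1 / cmod z, z.2 / cmod z).

Lemma invpi_ge0 (R : realType) : 0 <= (@pi R)^-1.
Proof. by rewrite invr_ge0 pi_ge0. Qed.

Definition area (R : realType) : {measure set (plane R) -> \bar R} :=
  mscale (NngNum (invpi_ge0 R)) (@lebesgue_measure R \x @lebesgue_measure R)%E.

Definition arclen (R : realType) (I : set (plane R)) : \bar R :=
  (((2 * pi)^-1)%:E *
   @lebesgue_measure R [set t : R | (0 <= t < 2 * pi)%R /\ I (expi t)])%E.

(* [J] is any kind of interval (open, closed, half-open, possibly unbounded);
   it yields the whole circle as soon as it is long enough. *)
Definition arc (R : realType) (I : set (plane R)) : Prop :=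
  (exists J : interval R, I = @expi R @` [set` J]) /\ (0 < arclen I)%E.

Definition carleson (R : realType) (I : set (plane R)) : set (plane R) :=
  [set z | [/\ disc z, z <> origin R, I (cdir z)
             & ((1 - cmod z)%:E < arclen I)%E]].

Definition avg (R : realType) (Q : set (plane R)) (f : plane R -> \bar R) :
    \bar R :=
  ((\int[area R]_(z in Q) f z) / area R Q)%E.

(* The library's [ess_inf] is over the whole space; extending f by +oo outside Q
   makes it the essential infimum over Q. *)
Definition ess_inf_on (R : realType) (Q : set (plane R))
    (f : plane R -> \bar R) : \bar R :=
  ess_inf (area R) (patch (cst +oo%E) Q f).

(* x ^ r on [0, +oo], with 0 ^ r = +oo and (+oo) ^ r = 0 for r < 0, unlike
   [poweR]. *)
Definition epow (R : realType) (x : \bar R) (r : R) : \bar R :=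
  if 0 <= r then poweR x r else poweR (inve x) (- r).

Definition weight (R : realType) (w : plane R -> \bar R) : Prop :=
  [/\ measurable_fun (@disc R) w,
      forall z, disc z -> (0 <= w z)%E
    & {ae area R, forall z, disc z -> (0 < w z < +oo)%E}].

Definition B1 (R : realType) (w : plane R -> \bar R) : Prop :=
  [/\ weight w, (area R).-integrable (@disc R) w
    & exists2 C : R, 0 < C & forall I, arc I ->
        (avg (carleson I) w <= C%:E * ess_inf_on (carleson I) w)%E].

Definition conj_exp (R : realType) (p : R) : R := p / (p - 1).

Definition Bp_gt1 (R : realType) (p : R) (w : plane R -> \bar R) : Prop :=
  [/\ weight w, (area R).-integrable (@disc R) w
    & exists2 C : R, 0 < C & forall I, arc I ->
        (avg (carleson I) w *
         epow (avg (carleson I) (fun z => epow (w z) (1 - conj_exp p))) (p - 1)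
         <= C%:E)%E].

Definition Bp (R : realType) (p : R) (w : plane R -> \bar R) : Prop :=
  (p = 1 /\ B1 w) \/ (1 < p /\ Bp_gt1 p w).

Definition radial_profile (R : realType) (w : plane R -> \bar R)
    (f : R -> \bar R) : Prop :=
  [/\ measurable_fun (`[0, 1[ : set (measurableTypeR R)) f,
      forall r, 0 <= r < 1 -> (0 <= f r)%E
    & forall z, disc z -> w z = f (cmod z)].

Definition monotonic_weight (R : realType) (w : plane R -> \bar R) : Prop :=
  weight w /\
  exists2 f : R -> \bar R, radial_profile w f &
    {in `[0, 1[ &, {homo f : r s / (r <= s)%R >-> (r <= s)%E}} \/
    {in `[0, 1[ &, {homo f : r s / (r <= s)%R >-> (s <= r)%E}}.

(* Main.v *)
From Pilot Require Import Defs.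
From mathcomp Require Import all_boot all_order all_algebra.
From mathcomp Require Import all_classical all_reals all_analysis.
From mathcomp Require Import measurable_realfun ess_sup_inf.
From mathcomp Require Import ring lra.
Import Pilot.Defs.

(** Let s = 1 - |z|^2 be the depth of z. Over the cone of directions in an arc, area
    is proportional to Lebesgue measure in s, because cones are invariant under
    dilations ([area_dilate], [area_shell]). A Carleson square is the part of a cone
    with depth less than some H ([carleson_box]), every H in ]0, 1] occurs
    ([exists_arc_box]), and the opening of the cone cancels from averages. For a
    radial weight w = psi(s) the conditions B_p are therefore conditions on the
    averages of psi over the intervals ]0, H[.

    A function psi which is decreasing in s satisfies B_p, for whichever p, exactly
    when its average over ]0, H[ is at most a constant times psi(H). Indeed the dual
    weight psi^(1 - p') is increasing, so its average over ]0, H[ is at most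
    psi(H)^(1 - p') and at least a quarter of psi(H / 2)^(1 - p'). Tested at
    H = 2^-j, this becomes a condition on the sequence psi(2^-k), namely
    [dyadic_dominated]: see [dyadic_dominated_antitone] for necessity and
    [Bp_antitone] for sufficiency. If psi is increasing and p > 1, the same holds
    with the dual weight in place of psi ([dyadic_dominated_monotone],
    [Bp_monotone]).

    The dyadic condition forces the terms 2^-k psi(2^-k) to decay geometrically,
    which leaves room for a slightly larger exponent ([dyadic_dominated_powR]).
    When psi is decreasing this yields the statement on w^(1 + eps), and membership
    in B_q is clear for every q > 1 since the dyadic condition does not involve p.
    When psi is increasing and p > 1, the improved condition for psi^(1 - p') is the
    dual condition for w^(1 + eps) with the same p, and also the one for w with the
    exponent q such that 1 - q' = (1 - p')(1 + eps), which is smaller than p. The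
    remaining case, psi increasing and p = 1, is that of a weight bounded between
    two positive constants ([B1_monotone_lower], [B1_bounded]). *)

Set Implicit Arguments.
Unset Strict Implicit.
Unset Printing Implicit Defensive.

Import Order.TTheory GRing.Theory Num.Theory.
Import numFieldNormedType.Exports.

Local Open Scope classical_set_scope.
Local Open Scope ring_scope.

(** * Dilations of the plane *)

Section scaling.
Context {R : realType}.
Implicit Types (c : R) (z : plane R).

Lemma measurable_mulc c :
  measurable_fun setT (fun x : measurableTypeR R => c * x : measurableTypeR R).
Proof. exact: measurable_funM. Qed.

(** Lebesgue measure is determined by its values on intervals, where the
    scaling rule is immediate. *)
Lemma lebesgue_measure_dilation c (A : set (measurableTypeR R)) : 0 < c ->
  measurable A ->
  (@lebesgue_measure R ((fun x : R => (c * x)%R) @^-1` A) =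
   (c^-1)%:E * @lebesgue_measure R A)%E.
Proof.
move=> c0 mA.
pose f : measurableTypeR R -> measurableTypeR R := fun x => c * x.
have mf : measurable_fun setT f by exact: measurable_mulc.
pose m' : {measure set (measurableTypeR R) -> \bar R} :=
  mscale (NngNum (ltW c0)) (pushforward (@lebesgue_measure R) f).
have -> : @lebesgue_measure R A = m' mf A.
  apply: lebesgue_measure_unique => //= _ [[a b]] _ <-.
  rewrite /mscale/= /pushforward.
  have -> : f @^-1` [set` `]a, b]] = [set` `](a / c), (b / c)]].
    apply/seteqP; split => x /=; rewrite !in_itv/= /f;
      by rewrite ltr_pdivrMr// ler_pdivlMr// mulrC.
  rewrite !lebesgue_measure_itv/= !lte_fin ltr_pM2r ?invr_gt0//.
  case: ifPn => _; last by rewrite mule0.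
  rewrite -!EFinB -EFinM; congr EFin; rewrite -mulrBl mulrCA divff ?mulr1//.
  by rewrite gt_eqF.
by rewrite /m'/= /mscale/= muleA -EFinM mulVf ?mul1e// gt_eqF.
Qed.

Definition dilate c z : plane R := (c * z.1, c * z.2).

Lemma measurable_dilate c : measurable_fun setT (dilate c).
Proof.
apply: measurable_fun_pair.
- by apply: (measurableT_comp (measurable_mulc c)); exact: measurable_fst.
- by apply: (measurableT_comp (measurable_mulc c)); exact: measurable_snd.
Qed.

(** The product measure is determined by its values on rectangles, and each of
    the two coordinates contributes one factor [c^-1]. *)
Lemma area_dilate c (A : set (plane R)) : 0 < c -> measurable A ->
  (area R (dilate c @^-1` A) = (c ^- 2)%:E * area R A)%E.
Proof.
move=> c0 mA.
pose m' : {measure set (plane R) -> \bar R} :=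
  mscale (NngNum (ltW (exprn_gt0 2 c0)))
    (pushforward (@lebesgue_measure R \x @lebesgue_measure R)%E (dilate c)).
have mf := measurable_dilate c.
have E : ((@lebesgue_measure R \x @lebesgue_measure R) A = m' mf A)%E.
  apply: product_measure_unique => //= B C mB mC.
  rewrite /mscale/= /pushforward.
  have -> : dilate c @^-1` (B `*` C) =
      ((fun x : R => c * x) @^-1` B) `*` ((fun x : R => c * x) @^-1` C).
    by apply/seteqP; split => -[x y].
  have mpre (D : set (measurableTypeR R)) : measurable D ->
      measurable ((fun x : R => c * x) @^-1` D).
    by move=> mD; rewrite -[X in measurable X]setTI; exact: measurable_mulc.
  rewrite product_measure1E; [|exact: mpre|exact: mpre].
  rewrite [X in (_ * (X * _))%E](lebesgue_measure_dilation c0 mB).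
  rewrite [X in (_ * (_ * X))%E](lebesgue_measure_dilation c0 mC).
  rewrite muleACA -EFinM -expr2 exprVn !muleA -EFinM mulfV ?mul1e//.
  by rewrite gt_eqF// exprn_gt0.
rewrite /area/= /mscale/= E /m'/= /mscale/= /pushforward.
rewrite [(_%:E * (pi^-1%:E * _))%E]muleCA; congr (_ * _)%E.
by rewrite muleA -EFinM mulVf ?mul1e// gt_eqF// exprn_gt0.
Qed.

End scaling.

(** * Arguments, arcs and cones *)

Section polar.
Context {R : realType}.
Implicit Types (z : plane R) (I : set (plane R)).

Lemma cmod_ge0 z : 0 <= cmod z. Proof. exact: sqrtr_ge0. Qed.

Lemma cmod_sqr z : cmod z ^+ 2 = z.1 ^+ 2 + z.2 ^+ 2.
Proof. by rewrite sqr_sqrtr// addr_ge0// sqr_ge0. Qed.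

Lemma cmod_eq0 z : (cmod z == 0) = (z == origin R).
Proof.
apply/eqP/eqP => [z0|->]; last by rewrite /cmod/= !expr0n/= addr0 sqrtr0.
have := cmod_sqr z; rewrite z0 expr0n/= => /esym/eqP.
rewrite paddr_eq0 ?sqr_ge0// !sqrf_eq0 => /andP[/eqP].
by case: z {z0} => x y /= -> /eqP ->.
Qed.

Lemma cmod_gt0 z : z <> origin R -> 0 < cmod z.
Proof. by move=> /eqP z0; rewrite lt_neqAle cmod_ge0 andbT eq_sym cmod_eq0. Qed.

Lemma cmod_dilate (c : R) z : 0 < c -> cmod (dilate c z) = c * cmod z.
Proof.
move=> c0; rewrite /cmod/= !exprMn -mulrDr sqrtrM ?sqr_ge0//.
by rewrite sqrtr_sqr gtr0_norm.
Qed.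

Lemma cdir_dilate (c : R) z : 0 < c -> cdir (dilate c z) = cdir z.
Proof.
move=> c0; rewrite /cdir cmod_dilate//=.
by rewrite !invfM !mulrA ![c * _ / c]mulrAC divff ?gt_eqF// !mul1r.
Qed.

Lemma measurable_cmod : measurable_fun setT (@cmod R : plane R -> R).
Proof.
apply: (@measurableT_comp _ _ _ _ _ _ (@Num.sqrt R)).
  by apply: continuous_measurable_fun; exact: sqrt_continuous.
apply: measurable_funD; apply: measurable_funX.
- exact: measurable_fst.
- exact: measurable_snd.
Qed.

(** The half-angle formula tan (t / 2) = y / (x + |z|) gives an argument in
    ]-pi, pi] which is visibly measurable; it breaks down only on the negative
    real axis, where x + |z| = 0. *)
Definition carg z : R :=
  if z.1 + cmod z == 0 then pi
  else 2 * atan (z.2 * (z.1 + cmod z) `^ (-1)).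

Lemma cmod_geN1 z : 0 <= z.1 + cmod z.
Proof.
suff : `|z.1| <= cmod z.
  by move=> h; have := ler_norm (- z.1); rewrite normrN => h'; lra.
rewrite -(@ler_pXn2r _ 2) ?nnegrE ?cmod_ge0// cmod_sqr real_normK ?num_real//.
by rewrite lerDl sqr_ge0.
Qed.

Lemma expi_carg z : z <> origin R -> expi (carg z) = cdir z.
Proof.
move=> z0; have r0 := cmod_gt0 z0; have := cmod_sqr z; have := cmod_geN1 z.
rewrite /carg /expi /cdir; move: (cmod z) r0 => r r0; case: z z0 => x y _ /=.
move=> xr E; case: eqVneq => [xr0|xr0].
  have y0 : y = 0.
    apply/eqP; rewrite -sqrf_eq0; apply/eqP.
    have := E; have -> : x = - r by lra.
    rewrite sqrrN; lra.
  rewrite cospi sinpi y0 mul0r; have -> : x = - r by lra.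
  by rewrite mulNr divff ?gt_eqF.
have {xr}xr : 0 < x + r by rewrite lt_neqAle eq_sym xr0.
rewrite powR_inv1 ?ltW//; set u := y / (x + r).
(* r is |z|, and y ^+ 2 = (r - x) * (r + x) simplifies everything below *)
have u2 : 1 + u ^+ 2 = 2 * r / (x + r).
  rewrite /u expr_div_n; apply/eqP.
  rewrite -(inj_eq (mulIf (_ : (x + r) ^+ 2 != 0))) ?sqrf_eq0//; apply/eqP.
  rewrite mulrDl mulfVK ?sqrf_eq0// mul1r.
  transitivity (2 * r * (x + r)); last by field.
  by rewrite -[y ^+ 2](addKr (x ^+ 2)) -E; ring.
have c2 : cos (atan u) ^+ 2 = (x + r) / (2 * r).
  rewrite cos_atan exprVn sqr_sqrtr ?u2 ?invf_div//.
  by rewrite divr_ge0// ltW// mulr_gt0.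
have cn0 : cos (atan u) != 0.
  rewrite -sqrf_eq0 c2 mulf_neq0// invr_neq0// mulf_neq0// ?gt_eqF//.
have s : sin (atan u) = u * cos (atan u).
  by apply: (mulIf (invr_neq0 cn0)); rewrite mulfK// -[RHS](atanK u).
rewrite mulr_natl cos_mulr2n sin_mulr2n s; congr pair.
  by rewrite c2; field; rewrite gt_eqF.
rewrite mulrCA -expr2 c2 /u; field; by rewrite !gt_eqF.
Qed.

Lemma measurable_carg : measurable_fun setT (carg : plane R -> measurableTypeR R).
Proof.
have mh : measurable_fun setT (fun z : plane R => z.1 + cmod z).
  by apply: measurable_funD; [exact: measurable_fst|exact: measurable_cmod].
apply: measurable_fun_ifT => //.
  exact: measurable_fun_eqr.
apply: measurable_funM => //.
apply: (@measurableT_comp _ _ _ _ _ _ (@atan R)).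
  by apply: continuous_measurable_fun => x; exact: continuous_atan.
apply: measurable_funM; first exact: measurable_snd.
by apply: (@measurableT_comp _ _ _ _ _ _ (@powR R ^~ (-1))).
Qed.

Lemma expi_2pin t (n : nat) : expi (t + 2 * pi * n%:R) = expi t :> plane R.
Proof.
have -> : 2 * pi * n%:R = (pi *+ 2) *+ n :> R by rewrite mulr_natr mulr_natl.
by rewrite /expi (periodicn (@sinD2pi R)) (periodicn (@cosD2pi R)).
Qed.

Lemma cos_lt1 (x : R) : 0 < x < 2 * pi -> cos x < 1.
Proof.
move=> /andP[x0 x2]; have -> : x = (x / 2) *+ 2 by rewrite -mulr_natr mulfVK.
rewrite cos_mulr2n cos2sin2 mulrnBl.
suff : 0 < sin (x / 2) ^+ 2 by rewrite mulr2n; lra.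
by rewrite exprn_gt0// sin_gt0_pi//; lra.
Qed.

(** If n periods are subtracted from [t - s] so as to land in [0, 2 pi[, the
    remainder has cosine 1, hence is 0. *)
Lemma expi_eq_shift s t : s <= t -> expi s = expi t :> plane R ->
  exists n : nat, t = s + 2 * pi * n%:R.
Proof.
move=> st e; have p0 : 0 < 2 * pi :> R by rewrite mulr_gt0// pi_gt0.
pose n := Num.truncn ((t - s) / (2 * pi)); exists n.
have /andP[n1 n2] : n%:R <= (t - s) / (2 * pi) < n.+1%:R.
  by apply: truncn_itv; apply: divr_ge0; [rewrite subr_ge0|exact: ltW].
move: n1 n2; rewrite ler_pdivlMr// ltr_pdivrMr// -natr1 => n1 n2.
have cd : cos (t - (s + 2 * pi * n%:R)) = 1.
  have := e; rewrite -(expi_2pin s n) /expi => -[ec es].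
  by rewrite cosB -ec -es -!expr2 cos2Dsin2.
have nd : ~ (0 < t - (s + 2 * pi * n%:R) < 2 * pi).
  by move=> /cos_lt1; rewrite cd ltxx.
apply/eqP; rewrite eq_le; apply/andP; split; last by lra.
by rewrite leNgt; apply/negP => h; apply: nd; apply/andP; split; lra.
Qed.

Lemma expi_inj : {in `[0, 2 * pi[ &, injective (@expi R)}.
Proof.
have main (s t : R) : 0 <= s -> s <= t -> t < 2 * pi -> expi s = expi t :> plane R -> s = t.
  move=> s0 st t2 /(expi_eq_shift st)[[|n] tE]; first by rewrite tE mulr0 addr0.
  have : (n.+1%:R : R) >= 1 by rewrite ler1n.
  by have := @pi_gt0 R; nra.
move=> s t; rewrite !in_itv/= => /andP[s0 s2] /andP[t0 t2] e.
by case: (leP s t) => [st|/ltW ts]; [exact: main|apply/esym/main].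
Qed.

Definition cone I : set (plane R) := [set z | z <> origin R /\ I (cdir z)].

Lemma cone_dilate I (c : R) : 0 < c -> dilate c @^-1` cone I = cone I.
Proof.
move=> c0; have oE z : (z <> origin R) = (cmod z != 0).
  by rewrite cmod_eq0; apply/propext; split => /eqP.
apply/seteqP; split => z; rewrite /cone/= !oE cdir_dilate// cmod_dilate//;
  by rewrite mulf_eq0 negb_or (gt_eqF c0).
Qed.

Lemma set1_origin : [set origin R] = [set 0] `*` [set 0].
Proof. by apply/seteqP; split => [_ ->//|[a b] /= [-> ->]]. Qed.

Lemma measurable_origin : measurable [set origin R].
Proof. by rewrite set1_origin; apply: measurableX; exact: measurable_set1. Qed.

(** This is where the arc has to be the image of an interval [J]: the cone
    consists of the points one of whose arguments, [carg] shifted by a multiple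
    of the period, lies in [J], so it is a countable union of preimages. *)
Lemma measurable_cone I : arc I -> measurable (cone I).
Proof.
move=> [[J ->] _].
have -> : cone (@expi R @` [set` J]) = ~` [set origin R] `&`
   (\bigcup_n ((fun z => carg z + 2 * pi * n%:R) @^-1` [set` J]) `|`
    \bigcup_n ((fun z => carg z - 2 * pi * n%:R) @^-1` [set` J])).
  apply/seteqP; split => z /=.
    move=> [z0 [t Jt]]; rewrite -expi_carg// => e; split => //.
    have [le|/ltW le] := leP (carg z) t.
      have [n nE] := expi_eq_shift le (esym e).
      by left; exists n => //=; rewrite -nE.
    have [n nE] := expi_eq_shift le e.
    by right; exists n => //=; rewrite nE addrK.
  move=> [z0 [[n _ /= Jn]|[n _ /= Jn]]]; split => //.
    by exists (carg z + 2 * pi * n%:R) => //; rewrite expi_2pin expi_carg.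
  exists (carg z - 2 * pi * n%:R) => //.
  by rewrite -(expi_2pin _ n) subrK expi_carg.
apply: measurableI.
  by apply: measurableC; exact: measurable_origin.
have mJ : measurable ([set` J] : set (measurableTypeR R)) by exact: measurable_itv.
apply: measurableU; apply: bigcup_measurable => n _.
all: rewrite -[X in measurable X]setTI; apply: (_ : measurable_fun _ _) => //.
all: by [apply: measurable_funD => //; exact: measurable_carg
        |apply: measurable_funB => //; exact: measurable_carg].
Qed.

End polar.

(** * Carleson squares as depth boxes *)

Section shells.
Context {R : realType}.
Implicit Types (z : plane R) (I : set (plane R)).

(** In terms of 1 - |z|^2, rather than 1 - |z|, normalised area on a cone becomes
    a multiple of Lebesgue measure on ]0, 1]. *)
Definition depth z : R := 1 - cmod z ^+ 2.

(** For an arc this is its normalised length; it cancels from averages. *)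
Definition aperture I : R := fine (area R (cone I `&` @disc R)).

Definition shell I (a b : R) : set (plane R) :=
  [set z | cone I z /\ a < depth z <= b].

Definition box I (H : R) : set (plane R) := [set z | cone I z /\ 0 < depth z < H].

Lemma disc_depth z : disc z = (0 < depth z <= 1) :> Prop.
Proof.
rewrite /disc/= /depth; apply/propext; split => [z1|/andP[z1 _]].
  apply/andP; split; last by rewrite gerBl sqr_ge0.
  by rewrite subr_gt0 -[ltRHS](expr1n _ 2) ltr_pXn2r ?nnegrE ?cmod_ge0.
rewrite -(@ltr_pXn2r _ 2) ?nnegrE ?cmod_ge0// expr1n; lra.
Qed.

Lemma measurable_depth : measurable_fun setT (depth : plane R -> R).
Proof.
by apply: measurable_funB => //; apply: measurable_funX; exact: measurable_cmod.
Qed.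

Lemma measurable_depth_itv (i : interval R) : measurable (depth @^-1` [set` i]).
Proof.
rewrite -[X in measurable X]setTI; exact: measurable_depth.
Qed.

Lemma measurable_disc : measurable (@disc R).
Proof.
have -> : @disc R = depth @^-1` `]0, 1].
  by apply/seteqP; split => z; rewrite disc_depth /= in_itv.
exact: measurable_depth_itv.
Qed.

Lemma measurable_shell I a b : arc I -> measurable (shell I a b).
Proof.
move=> aI; have -> : shell I a b = cone I `&` depth @^-1` `]a, b].
  by apply/seteqP; split => z; rewrite /shell/= in_itv.
by apply: measurableI; [exact: measurable_cone|exact: measurable_depth_itv].
Qed.

Lemma measurable_box I H : arc I -> measurable (box I H).
Proof.
move=> aI; have -> : box I H = cone I `&` depth @^-1` `]0, H[.
  by apply/seteqP; split => z; rewrite /box/= in_itv.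
by apply: measurableI; [exact: measurable_cone|exact: measurable_depth_itv].
Qed.

Lemma area_disc_fin : (area R (@disc R) < +oo)%E.
Proof.
have sub : @disc R `<=` `[-1, 1] `*` `[-1, 1].
  move=> z /=; rewrite disc_depth /depth cmod_sqr => /andP[z1 _].
  rewrite !in_itv/= -!ler_norml; split.
    rewrite -(@ler_pXn2r _ 2) ?nnegrE// real_normK ?num_real// expr1n.
    by have := sqr_ge0 z.2; lra.
  rewrite -(@ler_pXn2r _ 2) ?nnegrE// real_normK ?num_real// expr1n.
  by have := sqr_ge0 z.1; lra.
apply: le_lt_trans (le_measure _ _ _ sub) _.
- by rewrite inE; exact: measurable_disc.
- by rewrite inE; apply: measurableX; exact: measurable_itv.
rewrite /area/= /mscale/= product_measure1E; [|exact: measurable_itv..].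
rewrite [X in (_ * (X * _))%E]lebesgue_measure_itv/=.
rewrite [X in (_ * (_ * X))%E]lebesgue_measure_itv/=.
by rewrite lte_fin ifT ?EFinN -?EFinB -?EFinM ?ltry//; lra.
Qed.

Lemma aperture_ge0 I : 0 <= aperture I.
Proof. exact: fine_ge0. Qed.

Lemma area_cone_disc I : arc I -> area R (cone I `&` @disc R) = (aperture I)%:E.
Proof.
move=> aI; rewrite fineK// ge0_fin_numE//.
apply: le_lt_trans area_disc_fin; apply: le_measure; rewrite ?inE//.
- by apply: measurableI; [exact: measurable_cone|exact: measurable_disc].
- exact: measurable_disc.
Qed.

(** Cones are invariant under dilations, so this is the scaling rule for area;
    it replaces integration in polar coordinates. *)
Lemma area_cone_ball I (t : R) : arc I -> 0 <= t ->
  area R (cone I `&` [set z | cmod z ^+ 2 < t]) = (t * aperture I)%:E.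
Proof.
move=> aI; rewrite le_eqVlt => /predU1P[<-|t0].
  rewrite mul0r (_ : _ `&` _ = set0) ?measure0//.
  by apply/seteqP; split => z //= [_]; rewrite ltNge sqr_ge0.
have s0 : 0 < (Num.sqrt t)^-1 by rewrite invr_gt0 sqrtr_gt0.
have -> : cone I `&` [set z | cmod z ^+ 2 < t] =
    dilate (Num.sqrt t)^-1 @^-1` (cone I `&` @disc R).
  rewrite preimage_setI cone_dilate//; congr (_ `&` _).
  apply/seteqP; split => z; rewrite /disc/= cmod_dilate//.
    move=> zt; rewrite mulrC ltr_pdivrMr ?sqrtr_gt0// mul1r.
    by rewrite -(@ltr_pXn2r _ 2) ?nnegrE ?cmod_ge0 ?sqrtr_ge0// (sqr_sqrtr (ltW t0)).
  rewrite mulrC ltr_pdivrMr ?sqrtr_gt0// mul1r.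
  by rewrite -(@ltr_pXn2r _ 2) ?nnegrE ?cmod_ge0 ?sqrtr_ge0// (sqr_sqrtr (ltW t0)).
rewrite area_dilate//; last first.
  by apply: measurableI; [exact: measurable_cone|exact: measurable_disc].
by rewrite area_cone_disc// exprVn invrK sqr_sqrtr ?ltW.
Qed.

Lemma area_shell I (a b : R) : arc I -> 0 <= a -> a <= b -> b <= 1 ->
  area R (shell I a b) = ((b - a) * aperture I)%:E.
Proof.
move=> aI a0 ab b1.
pose B t := cone I `&` [set z : plane R | cmod z ^+ 2 < t].
have mB t : measurable (B t).
  have -> : B t = cone I `&` depth @^-1` `]1 - t, +oo[.
    by apply/seteqP; split => z [Iz /= zt]; split => //=;
      move: zt; rewrite in_itv/= andbT /depth; lra.
  by apply: measurableI; [exact: measurable_cone|exact: measurable_depth_itv].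
have -> : shell I a b = B (1 - a) `\` B (1 - b).
  apply/seteqP; split => z; rewrite /shell /B/= /depth.
    move=> [Iz /andP[az zb]]; split; first by split => //; lra.
    by move=> [_]; rewrite ltNge => /negP; apply; lra.
  move=> [[Iz az] nb]; split => //; apply/andP; split; first lra.
  by rewrite leNgt; apply/negP => h; apply: nb; split => //; lra.
have BB : B (1 - a) `&` B (1 - b) = B (1 - b).
  by apply/setIidPr => z [Iz /= zb]; split => //=; lra.
have EB t : 0 <= t -> area R (B t) = (t * aperture I)%:E by exact: area_cone_ball.
have Ba : area R (B (1 - a)) = ((1 - a) * aperture I)%:E.
  by apply: EB; rewrite subr_ge0 (le_trans ab).
transitivity (area R (B (1 - a)%R) - area R (B (1 - b)%R))%E.
  by rewrite -[X in (_ - area R X)%E]BB; apply: measureD => //; rewrite [X in (X < _)%E]Ba ltry.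
rewrite Ba EB ?subr_ge0// -EFinB; congr EFin; ring.
Qed.

Lemma carlesonE I z : carleson I z <->
  [/\ cone I z, disc z & ((1 - cmod z)%:E < arclen I)%E].
Proof. by rewrite /carleson /cone/=; split => [[]|[[]]]. Qed.

Lemma carleson_arclen I (h : R) : 0 < h <= 1 -> arclen I = h%:E ->
  carleson I = box I (1 - (1 - h) ^+ 2).
Proof.
move=> /andP[h0 h1] hE.
apply/seteqP; split => z; rewrite carlesonE hE lte_fin /box disc_depth /=.
  move=> [Iz /andP[d0 d1] zh]; split => //; rewrite d0/= /depth.
  by rewrite ltrD2l ltrN2 ltr_pXn2r ?nnegrE ?cmod_ge0//; lra.
move=> [Iz /andP[d0]]; rewrite /depth ltrD2l ltrN2.
rewrite ltr_pXn2r ?nnegrE ?cmod_ge0//; last lra.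
by move=> zh; split => //; [rewrite d0/= gerBl sqr_ge0|lra].
Qed.

(** The length of the arc enters only through the height of the box: for an arc
    of full length the box has height 1. *)
Lemma carleson_box I : arc I -> exists2 H, 0 < H <= 1 & carleson I = box I H.
Proof.
move=> aI; have l0 := aI.2; have [l1|l1] := leP 1%E (arclen I).
  exists 1; first by rewrite ltr01 lexx.
  apply/seteqP; split => z; rewrite carlesonE /box disc_depth /=.
    move=> [[z0 Iz] /andP[d0 _] _]; split => //; rewrite d0/= /depth gtrBl.
    by rewrite exprn_gt0// cmod_gt0.
  move=> [[z0 Iz] /andP[d0 d1]]; split => //; first by rewrite d0 ltW.
  by apply: lt_le_trans l1; rewrite lte_fin gtrBl cmod_gt0.
have [h hE] : exists h, arclen I = h%:E.
  by exists (fine (arclen I)); rewrite fineK// ge0_fin_numE ?(lt_trans l1) ?ltry// ltW.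
move: l0 l1; rewrite hE !lte_fin => h0 h1.
exists (1 - (1 - h) ^+ 2); last by rewrite (carleson_arclen _ hE)// h0 ltW.
by have h2 := sqr_ge0 (1 - h); apply/andP; split; [nra|lra].
Qed.

Lemma arclen_itv (h : R) : 0 <= h <= 1 ->
  arclen (@expi R @` `[0, 2 * pi * h[) = h%:E.
Proof.
move=> /andP[h0 h1]; have p0 := @pi_gt0 R.
rewrite /arclen (_ : [set t | _] = `[0, 2 * pi * h[%classic); last first.
  apply/seteqP; split => t /=.
    move=> [/andP[t0 t2] [u]]; rewrite in_itv/= => /andP[u0 uh] e.
    rewrite in_itv/= t0/= -(expi_inj _ _ e) ?in_itv//= ?u0 ?t0//=.
    by apply: lt_le_trans uh _; nra.
  rewrite in_itv/= => /andP[t0 th]; split; last first.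
    by exists t => //; rewrite in_itv/= t0.
  by rewrite t0/=; apply: lt_le_trans th _; nra.
rewrite lebesgue_measure_itv/= lte_fin.
case: ifPn => [_|]; last first.
  rewrite -leNgt => hle; rewrite mule0; congr EFin.
  by apply/eqP; rewrite eq_le h0/=; nra.
by rewrite -EFinB -EFinM; congr EFin; rewrite subr0 mulKf// gt_eqF// mulr_gt0.
Qed.

Lemma aperture_le (I J : set (plane R)) : arc I -> arc J -> I `<=` J ->
  aperture I <= aperture J.
Proof.
move=> aI aJ IJ; rewrite -lee_fin -!area_cone_disc//; apply: le_measure.
- by rewrite inE; apply: measurableI; [exact: measurable_cone|exact: measurable_disc].
- by rewrite inE; apply: measurableI; [exact: measurable_cone|exact: measurable_disc].
- by move=> z [[z0 Iz] dz]; split => //; split => //; exact: IJ.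
Qed.

Lemma arc_itv (h : R) : 0 < h <= 1 -> arc (@expi R @` `[0, 2 * pi * h[).
Proof.
move=> /andP[h0 h1]; split; first by eexists.
by rewrite arclen_itv ?h1 ?ltW// lte_fin.
Qed.

(** A sector of small angle 2 pi k contains the rectangle
    ]1/4, 1/2[ * ]0, sin (2 pi k) / 4[, whose points have an argument with sine
    below sin (2 pi k). *)
Lemma aperture_gt0 (h : R) : 0 < h <= 1 ->
  0 < aperture (@expi R @` `[0, 2 * pi * h[).
Proof.
move=> /andP[h0 h1]; have p0 := @pi_gt0 R.
(* dividing by 8 keeps the angle in the range where sine is increasing *)
pose k := h / 8; have k0 : 0 < k by rewrite divr_gt0.
have kh : k <= h by rewrite /k; lra.
have k1 : 0 < k <= 1 by rewrite k0 (le_trans kh).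
have h1' : 0 < h <= 1 by rewrite h0.
apply: (@lt_le_trans _ _ (aperture (@expi R @` `[0, 2 * pi * k[))); last first.
  apply: aperture_le; [exact: arc_itv|exact: arc_itv|].
  move=> _ [t /= tk <-]; exists t => //=; move: tk; rewrite !in_itv/=.
  by move=> /andP[-> tk]/=; apply: lt_le_trans tk _; rewrite ler_pM2l// mulr_gt0.
have pk : 0 < 2 * pi * k < pi / 2.
  by rewrite /k; apply/andP; split; nra.
pose d := sin (2 * pi * k).
have d0 : 0 < d by apply: sin_gt0_pihalf.
have d1 : d <= 1 by exact: sin_le1.
rewrite -lte_fin -area_cone_disc; last exact: arc_itv.
apply: (@lt_le_trans _ _ (area R (`]1/4, 1/2[ `*` `]0, d / 4[))).
  rewrite /area/= /mscale/= product_measure1E; [|exact: measurable_itv..].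
  rewrite [X in (_ * (X * _))%E]lebesgue_measure_itv/=.
  rewrite [X in (_ * (_ * X))%E]lebesgue_measure_itv/=.
  rewrite !lte_fin divr_gt0// ifT; last by lra.
  rewrite -!EFinB -!EFinM lte_fin; apply: mulr_gt0; first by rewrite invr_gt0.
  by apply: mulr_gt0; lra.
apply: le_measure; rewrite ?inE.
- by apply: measurableX; exact: measurable_itv.
- apply: measurableI; last exact: measurable_disc.
  by apply: measurable_cone; exact: arc_itv.
move=> [x y] [/=]; rewrite !in_itv/= => /andP[x4 x2] /andP[y0 y4].
have x0 : 0 < x by lra.
have cE := cmod_sqr (x, y); rewrite /= in cE.
have xc : x < cmod (x, y).
  by rewrite -(@ltr_pXn2r _ 2) ?nnegrE ?cmod_ge0 ?ltW// cE ltrDl exprn_gt0.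
have c0 : 0 < cmod (x, y) by exact: lt_trans xc.
have c1 : cmod (x, y) < 1.
  rewrite -(@ltr_pXn2r _ 2) ?nnegrE ?cmod_ge0// cE expr1n; nra.
split; last by [].
split; first by move=> /(congr1 fst)/= E; rewrite E ltxx in x0.
have ryd : 0 < y / cmod (x, y) < d.
  rewrite divr_gt0//= ltr_pdivrMr//; nra.
set u := y / cmod (x, y) in ryd *; have /andP[u0 ud] := ryd.
have u1 : -1 <= u <= 1 by lra.
have cu : Num.sqrt (1 - u ^+ 2) = x / cmod (x, y).
  have -> : 1 - u ^+ 2 = (x / cmod (x, y)) ^+ 2.
    rewrite /u !expr_div_n cE.
    have : x ^+ 2 + y ^+ 2 != 0 by rewrite -cE gt_eqF// exprn_gt0.
    by move=> ?; field.
  by rewrite sqrtr_sqr ger0_norm// divr_ge0 ?ltW.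
exists (asin u) => /=; last first.
  by rewrite /expi /cdir/= cos_asin// asinK ?in_itv// cu.
rewrite in_itv/=; apply/andP; split.
  rewrite leNgt -ltr_sin ?in_itv/= ?asin_geNpi2 ?asin_lepi2//; last lra.
  by rewrite asinK ?in_itv// sin0 -leNgt ltW.
rewrite -ltr_sin ?in_itv/= ?asin_geNpi2 ?asin_lepi2//; last lra.
by rewrite asinK ?in_itv.
Qed.

(** Every height is attained by some Carleson square of positive area, so the
    weight condition may be tested on any box. *)
Lemma exists_arc_box (H : R) : 0 < H <= 1 ->
  exists I, [/\ arc I, 0 < aperture I & carleson I = box I H].
Proof.
move=> /andP[H0 H1]; pose h := 1 - Num.sqrt (1 - H).
have h01 : 0 < h <= 1.
  rewrite /h gerBl sqrtr_ge0 andbT subr_gt0 -[ltRHS]sqrtr1.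
  by rewrite ltr_sqrt// gtrBl.
exists (@expi R @` `[0, 2 * pi * h[); split.
- exact: arc_itv.
- exact: aperture_gt0.
- rewrite (carleson_arclen h01); last by rewrite arclen_itv// ltW; case/andP: h01.
  have -> : 1 - h = Num.sqrt (1 - H) by rewrite /h; ring.
  by rewrite sqr_sqrtr ?subr_ge0//; congr box; ring.
Qed.

End shells.

(** * Self-improvement for dyadic sequences *)

Section dyadic_sequences.
Context {R : realType}.
Implicit Types a : nat -> R.

(** Discrete form of the A_1 condition at the origin of ]0, 1] for a decreasing
    function with value [a k] at [2 ^- k]. *)
Definition dyadic_dominated a : Prop :=
  exists2 K : R, 0 < K & forall j N : nat,
    \sum_(j <= k < N) 2 ^- k * a k <= K * (2 ^- j * a j).

(** The weight condition only controls the tail from [j.+1] on; replacing [j.+1]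
    by [j] costs a factor 2, except at the top scale, where the missing first term
    is absorbed in the constant through the ratio of the first two values. *)
Lemma dyadic_dominated_shift a : (forall k, 0 < a k) ->
  (exists2 K : R, 0 < K & forall j N : nat,
    \sum_(j.+1 <= k < N) 2 ^- k * a k <= K * (2 ^- j * a j.+1)) ->
  dyadic_dominated a.
Proof.
move=> a0 [K K0 h]; exists (1 + 2 * K + K * (a 1%N / a 0%N)).
  by rewrite !addr_gt0// ?mulr_gt0// invr_gt0.
move=> [|j] N.
- case: N => [|N].
    by rewrite big_geq// mulr_ge0 ?mulr_ge0 ?ltW ?invr_ge0 ?addr_gt0 ?mulr_gt0 ?invr_gt0.
  rewrite big_ltn// expr0 invr1 !mul1r.
  apply: (@le_trans _ _ (a 0%N + K * a 1%N)).
    by rewrite lerD2l; have := h 0%N N.+1; rewrite expr0 invr1 mul1r.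
  rewrite !mulrDl mul1r -!mulrA mulVf ?gt_eqF// mulr1.
  by have := mulr_gt0 K0 (a0 0%N); lra.
- apply: le_trans (h _ _) _.
  have -> : (2 ^- j : R) = 2 * 2 ^- j.+1.
    by rewrite exprS invfM mulrA divff ?mul1r.
  have b0 : 0 < 2 ^- j.+1 * a j.+1 :> R by rewrite mulr_gt0// invr_gt0 exprn_gt0.
  rewrite -[2 * _ * _]mulrA; move: (2 ^- j.+1 * _) b0 => b b0.
  have : 0 < K * (a 1%N / a 0%N) by rewrite !mulr_gt0// invr_gt0.
  by move: (K * (_ / _)) => c c0; have := mulr_gt0 c0 b0; lra.
Qed.

(** The tail sum T j of b k = 2 ^- k * a k satisfies T j <= K * b j, so that
    removing b j from it shrinks it by the fixed factor 1 - K^-1. *)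
Lemma dyadic_dominated_decay a : (forall k, 0 < a k) -> dyadic_dominated a ->
  exists K theta : R, [/\ 0 < K, 0 < theta < 1 & forall j n : nat,
    2 ^- (j + n) * a (j + n)%N <= K * theta ^+ n * (2 ^- j * a j)].
Proof.
move=> a0 [K0 K00 h]; pose b k := 2 ^- k * a k.
have b0 k : 0 < b k by rewrite mulr_gt0// invr_gt0 exprn_gt0.
(* K0 may be 1, which would make theta vanish *)
pose K := K0 + 1; have K1 : 1 < K by rewrite /K; lra.
have Kp : 0 < K by lra.
pose T j N := \sum_(j <= k < N) b k.
have TK j N : T j N <= K * b j.
  by apply: le_trans (h j N) _; rewrite (ler_pM2r (b0 j)) /K; lra.
pose theta := 1 - K^-1.
have th : 0 < theta < 1.
  rewrite /theta; have : 0 < K^-1 by rewrite invr_gt0.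
  have : K^-1 < 1 by rewrite invf_lt1.
  by move=> ? ?; apply/andP; split; lra.
have /andP[th0 th1] := th.
have step j N : T j.+1 N <= theta * T j N.
  have [jN|Nj] := ltnP j N; last first.
    by rewrite /T !big_geq ?mulr0// (leq_trans Nj).
  have E : T j N = b j + T j.+1 N by rewrite /T big_ltn.
  have : K^-1 * T j N <= b j by rewrite mulrC ler_pdivrMr// mulrC.
  by rewrite /theta mulrBl mul1r E; lra.
exists K, theta; split => // j n.
have iter N : T (j + n)%N N <= theta ^+ n * T j N.
  elim: n => [|n IH]; first by rewrite addn0 expr0 mul1r.
  rewrite addnS; apply: le_trans (step _ _) _.
  by rewrite exprS -mulrA; apply: ler_wpM2l IH; exact: ltW.
have -> : 2 ^- (j + n) * a (j + n)%N = T (j + n)%N (j + n).+1.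
  by rewrite /T big_nat1.
apply: le_trans (iter _) _; rewrite mulrAC [K * _]mulrC [leRHS]mulrC.
apply: ler_wpM2l; last by rewrite mulrC; exact: TK.
by rewrite exprn_ge0// ltW.
Qed.

Lemma geometric_sum_le (r : R) (n : nat) : 0 < r < 1 ->
  \sum_(0 <= i < n) r ^+ i <= (1 - r)^-1.
Proof.
move=> /andP[r0 r1]; rewrite -div1r ler_pdivlMr ?subr_gt0//.
suff -> : (\sum_(0 <= i < n) r ^+ i) * (1 - r) = 1 - r ^+ n.
  by have := exprn_gt0 n r0; lra.
elim: n => [|n IH]; first by rewrite big_geq// mul0r expr0 subrr.
by rewrite big_nat_recr//= mulrDl IH exprS; ring.
Qed.

Lemma powRXn (x e : R) (n : nat) : 0 <= x -> (x `^ e) ^+ n = (x ^+ n) `^ e.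
Proof. by move=> x0; rewrite -powR_mulrn ?powR_ge0// powRAC powR_mulrn. Qed.

(** Geometric decay leaves room for a small power: the n-th term of the new sum
    gains at most a factor 2 `^ (n * eps), and it still decays as long as
    2 `^ eps * theta < 1. *)
Lemma dyadic_dominated_powR a : (forall k, 0 < a k) -> dyadic_dominated a ->
  exists2 eps : R, 0 < eps & dyadic_dominated (fun k => a k `^ (1 + eps)).
Proof.
move=> a0 /(dyadic_dominated_decay a0)[K [theta [K0 /andP[th0 th1] decay]]].
have [eps eps0 r01] : exists2 eps : R, 0 < eps & 0 < 2 `^ eps * theta < 1.
  (* eps is chosen so that 2 `^ eps is the midpoint of 1 and theta^-1 *)
  have thV : 1 < theta^-1 by rewrite invf_gt1.
  have l1 : 1 < (1 + theta^-1) / 2 by lra.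
  have ln20 : 0 < ln (2 : R) by rewrite ln_gt0// ltr1n.
  exists (ln ((1 + theta^-1) / 2) / ln 2); first by rewrite divr_gt0// ln_gt0.
  rewrite /powR pnatr_eq0/= mulfVK ?gt_eqF// lnK ?posrE ?(lt_trans _ l1)//.
  rewrite mulr_gt0 ?(lt_trans _ l1)//= mulrAC mulrDl mulVf ?gt_eqF//; lra.
pose lam := 2 `^ eps; pose r := lam * theta.
have /andP[r0 r1] := r01.
exists eps => //; exists (K * K `^ eps * (1 - r)^-1).
  by rewrite !mulr_gt0 ?powR_gt0// invr_gt0 subr_gt0.
move=> j N.
have pow k : a k `^ (1 + eps) = a k * a k `^ eps.
  by rewrite powRD ?powRr1 ?ltW//; apply/implyP => _; rewrite gt_eqF.
have term n : 2 ^- (j + n) * a (j + n)%N `^ (1 + eps) <=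
    K * K `^ eps * r ^+ n * (2 ^- j * a j `^ (1 + eps)).
  rewrite !pow mulrA.
  have da : a (j + n)%N `^ eps <= K `^ eps * lam ^+ n * a j `^ eps.
    have -> : K `^ eps * lam ^+ n * a j `^ eps = (K * 2 ^+ n * a j) `^ eps.
      rewrite !powRM ?ltW// ?mulr_gt0 ?exprn_gt0//; congr (_ * _ * _).
      by rewrite /lam powRXn.
    apply: ge0_ler_powR; [exact: ltW|by rewrite nnegrE ltW| |].
      by rewrite nnegrE ltW// !mulr_gt0// exprn_gt0.
    have p2 : 0 < 2 ^+ (j + n) :> R by rewrite exprn_gt0.
    rewrite -(@ler_pM2l _ (2 ^- (j + n))) ?invr_gt0//.
    apply: le_trans (decay _ _) _.
    have -> : 2 ^- (j + n) * (K * 2 ^+ n * a j) = K * (2 ^- j * a j).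
      by rewrite exprD; field; rewrite !expf_neq0.
    rewrite -mulrA ler_pM2l// ler_piMl//.
      by rewrite mulr_ge0 ?invr_ge0 ?exprn_ge0// ltW.
    by rewrite exprn_ile1// ltW.
  apply: le_trans (ler_pM _ _ (decay _ _) da) _.
  - by rewrite mulr_ge0 ?invr_ge0 ?exprn_ge0// ltW.
  - exact: powR_ge0.
  by rewrite /r (exprMn n lam theta) le_eqVlt; apply/orP; left; apply/eqP; ring.
have C0 : 0 <= K * K `^ eps * (1 - r)^-1.
  by apply: ltW; rewrite !mulr_gt0 ?powR_gt0// invr_gt0 subr_gt0.
have B0 : 0 <= 2 ^- j * a j `^ (1 + eps).
  by rewrite mulr_ge0 ?powR_ge0// invr_ge0 exprn_ge0.
have [jN|Nj] := leqP j N; last by rewrite (big_geq (ltnW Nj)) mulr_ge0.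
rewrite -{1}[j]add0n big_addn.
apply: (@le_trans _ _ (\sum_(0 <= n < N - j)
    K * K `^ eps * r ^+ n * (2 ^- j * a j `^ (1 + eps)))).
  by apply: ler_sum => n _; rewrite addnC; exact: term.
rewrite -mulr_suml -mulr_sumr; apply: ler_wpM2r => //.
apply: ler_wpM2l; last exact: geometric_sum_le.
by rewrite mulr_ge0 ?powR_ge0// ltW.
Qed.

End dyadic_sequences.

(** * Averages *)

Section averages.
Context {R : realType}.
Implicit Types (z : plane R) (I Q : set (plane R)) (phi psi : R -> R).
Local Open Scope ereal_scope.

Lemma avg_ge0 Q (f : plane R -> \bar R) : (forall z, Q z -> 0 <= f z) -> 0 <= avg Q f.
Proof. by move=> f0; rewrite /avg mule_ge0 ?integral_ge0 ?inve_ge0. Qed.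

Lemma avg_le Q (f : plane R -> \bar R) (M : R) : area R Q < +oo ->
  (forall z, Q z -> 0 <= f z) -> (0 <= M)%R ->
  \int[area R]_(z in Q) f z <= M%:E * area R Q -> avg Q f <= M%:E.
Proof.
move=> Qoo f0 M0; rewrite /avg.
have [a aE] : exists a, area R Q = a%:E.
  by exists (fine (area R Q)); rewrite fineK// ge0_fin_numE.
have a0 : (0 <= a)%R by rewrite -lee_fin -aE.
rewrite aE => h.
have [a00|an0] := eqVneq a 0%R.
  have -> : \int[area R]_(z in Q) f z = 0.
    apply/eqP; rewrite eq_le integral_ge0// andbT.
    by apply: le_trans h _; rewrite a00 mule0.
  by rewrite mul0e.
have ap : (0 < a)%R by rewrite lt_neqAle eq_sym an0.
rewrite inver (negbTE an0); apply: le_trans (lee_wpmul2r _ h) _.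
  by rewrite lee_fin invr_ge0.
by rewrite -muleA -!EFinM divff// mulr1.
Qed.

Lemma avg_ge Q (f : plane R -> \bar R) (a c : R) : (0 < a)%R ->
  0 < area R Q -> area R Q <= a%:E -> (0 <= c)%R ->
  (c * a)%:E <= \int[area R]_(z in Q) f z -> c%:E <= avg Q f.
Proof.
move=> a0 Q0 Qa c0 h; rewrite /avg.
have [q qE] : exists q, area R Q = q%:E.
  by exists (fine (area R Q)); rewrite fineK// ge0_fin_numE// (le_lt_trans Qa) ?ltry.
move: Q0 Qa; rewrite qE lte_fin lee_fin => q0 qa.
rewrite inver gt_eqF//; apply: le_trans (lee_wpmul2r _ h); last first.
  by rewrite lee_fin invr_ge0 ltW.
rewrite -EFinM lee_fin ler_pdivlMr// ler_wpM2l//.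
Qed.

End averages.

(** * Radial integrals over boxes *)

Section radial.
Context {R : realType}.
Implicit Types (z : plane R) (I Q : set (plane R)) (phi psi : R -> R).

Definition positive_on psi : Prop := forall s, 0 < s <= 1 -> 0 < psi s.
Definition antitone_on phi : Prop :=
  forall s t, 0 < s -> s <= t -> t <= 1 -> phi t <= phi s.
Definition monotone_on psi : Prop :=
  forall s t, 0 < s -> s <= t -> t <= 1 -> psi s <= psi t.
Definition measurable_profile psi : Prop :=
  measurable_fun (@disc R) (fun z => psi (depth z)).

Lemma measurable_profile_powR psi r : measurable_profile psi ->
  measurable_profile (fun s => psi s `^ r).
Proof. by move=> mpsi; apply: (measurableT_comp (measurable_powR r)). Qed.

Lemma box_disc I H : 0 < H <= 1 -> box I H `<=` @disc R.
Proof.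
by move=> /andP[_ H1] z [_ /andP[d0 dH]]; rewrite disc_depth d0 (le_trans (ltW dH)).
Qed.

Lemma shell_disc I a b : 0 <= a -> b <= 1 -> shell I a b `<=` @disc R.
Proof.
move=> a0 b1 z [_ /andP[az zb]].
by rewrite disc_depth (le_lt_trans a0)//= (le_trans zb).
Qed.

Lemma shell_box I a b H : 0 <= a -> b < H -> shell I a b `<=` box I H.
Proof.
move=> a0 bH z [Iz /andP[az zb]].
by split => //; rewrite (le_lt_trans a0)//= (le_lt_trans zb).
Qed.

Lemma measurable_profileS psi Q : measurable_profile psi -> Q `<=` @disc R ->
  measurable_fun Q (fun z => (psi (depth z))%:E).
Proof.
move=> mpsi Qd; apply/measurable_EFinP.
by apply: measurable_funS mpsi => //; exact: measurable_disc.
Qed.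

Local Open Scope ereal_scope.

Lemma area_box_le I H : arc I -> (0 < H <= 1)%R -> area R (box I H) <= (H * aperture I)%:E.
Proof.
move=> aI /andP[H0 H1]; rewrite -[X in (X * _)%R]subr0 -area_shell ?(ltW H0)//.
apply: le_measure; rewrite ?inE; [exact: measurable_box|exact: measurable_shell|].
by move=> z [Iz /andP[z0 zH]]; split => //; rewrite z0 ltW.
Qed.

Lemma area_box_ge I H : arc I -> (0 < H <= 1)%R -> (H / 2 * aperture I)%:E <= area R (box I H).
Proof.
move=> aI /andP[H0 H1]; rewrite -[X in (X * _)%R]subr0 -area_shell//; [|lra..].
apply: le_measure; rewrite ?inE; [exact: measurable_shell|exact: measurable_box|].
by apply: shell_box; lra.
Qed.

Lemma area_box_fin I H : arc I -> (0 < H <= 1)%R -> area R (box I H) < +oo.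
Proof. by move=> aI H01; apply: le_lt_trans (area_box_le aI H01) _; rewrite ltry. Qed.

Lemma integral_le_const psi Q (M : R) : measurable Q -> Q `<=` @disc R ->
  positive_on psi -> measurable_profile psi ->
  (forall z, Q z -> psi (depth z) <= M)%R ->
  \int[area R]_(z in Q) (psi (depth z))%:E <= M%:E * area R Q.
Proof.
move=> mQ Qd pos mpsi h; rewrite -integral_cst//; apply: ge0_le_integral => //.
- by move=> z /Qd; rewrite disc_depth lee_fin => /pos/ltW.
- exact: measurable_profileS.
Qed.

Lemma integral_ge_const psi Q (M : R) : measurable Q -> Q `<=` @disc R ->
  (0 <= M)%R -> measurable_profile psi ->
  (forall z, Q z -> M <= psi (depth z))%R ->
  M%:E * area R Q <= \int[area R]_(z in Q) (psi (depth z))%:E.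
Proof.
move=> mQ Qd M0 mpsi h; rewrite -integral_cst//; apply: ge0_le_integral => //.
exact: measurable_profileS.
Qed.

Definition dyad (k : nat) : R := (2 ^- k)%R.

Lemma dyad_gt0 k : (0 < dyad k)%R.
Proof. by rewrite invr_gt0 exprn_gt0. Qed.

Lemma dyadS k : dyad k.+1 = (dyad k / 2)%R.
Proof. by rewrite /dyad exprS invfM mulrC. Qed.

Lemma dyad_le1 k : (dyad k <= 1)%R.
Proof. by rewrite /dyad invf_le1 ?exprn_ege1 ?exprn_gt0// ler1n. Qed.

Lemma dyad_itv k : (0 < dyad k <= 1)%R.
Proof. by rewrite dyad_gt0 dyad_le1. Qed.

Lemma dyad_le j k : (j <= k)%N -> (dyad k <= dyad j)%R.
Proof.
by move=> jk; rewrite lef_pV2 ?posrE ?exprn_gt0// ler_weXn2l// ler1n.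
Qed.

Lemma dyad_lt (e : R) : (0 < e)%R -> exists k, (dyad k < e)%R.
Proof.
move=> e0; exists (Num.truncn e^-1).
rewrite /dyad invf_plt ?posrE ?exprn_gt0//.
have eV : (0 <= e^-1)%R by rewrite invr_ge0 ltW.
have /andP[_ h] := truncn_itv eV; apply: lt_le_trans h _.
by rewrite -natrX ler_nat ltn_expl.
Qed.

Lemma dyad_bracket (s : R) : (0 < s <= 1)%R -> exists k, (dyad k.+1 < s <= dyad k)%R.
Proof.
move=> /andP[s0 s1].
have P : exists k, (dyad k < s)%R by exact: dyad_lt.
case: (ex_minnP P) => -[|k] ks kmin.
  by move: ks; rewrite /dyad expr0 invr1 ltNge s1.
exists k; rewrite ks/= leNgt; apply/negP => /kmin; by rewrite ltnn.
Qed.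

Lemma shells_trivIset I (j : nat) :
  trivIset setT (fun k => shell I (dyad (j + k).+1) (dyad (j + k))).
Proof.
apply/trivIsetP => m n _ _ mn.
wlog: m n mn / (m < n)%N.
  move=> h; case: (ltngtP m n) => [|nm|mnE]; first exact: h.
    by rewrite setIC; apply: h => //; rewrite eq_sym.
  by rewrite mnE eqxx in mn.
move=> {}mn; rewrite -subset0 => z [[_ /andP[mz _]] [_ /andP[_ zn]]] /=.
have : (dyad (j + n) <= dyad (j + m).+1)%R.
  by apply: dyad_le; rewrite -addnS leq_add2l.
by move=> h; have := lt_le_trans mz (le_trans zn h); rewrite ltxx.
Qed.

Lemma box_sub_shells I (j : nat) H : (H <= dyad j)%R ->
  box I H `<=` \bigcup_k shell I (dyad (j + k).+1) (dyad (j + k)).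
Proof.
move=> Hj z [Iz /andP[z0 zH]].
have z1 : (depth z <= 1)%R by rewrite (le_trans (ltW zH))// (le_trans Hj)// dyad_le1.
have [k /andP[kz zk]] : exists k, (dyad k.+1 < depth z <= dyad k)%R.
  by apply: dyad_bracket; rewrite z0.
have jk : (j <= k)%N.
  rewrite leqNgt; apply/negP => kj; have := dyad_le kj; rewrite leNgt => /negP; apply.
  by apply: lt_le_trans kz _; rewrite (le_trans (ltW zH)).
by exists (k - j)%N => //; rewrite subnKC//; split => //; rewrite kz.
Qed.

Lemma area_dyadic_shell I k : arc I ->
  area R (shell I (dyad k.+1) (dyad k)) = (dyad k.+1 * aperture I)%:E.
Proof.
move=> aI; rewrite area_shell ?dyad_le1 ?dyad_le ?(ltW (dyad_gt0 _))//.
by rewrite dyadS; congr (_ * _)%:E; lra.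
Qed.

(** For a decreasing profile the integral over a box is bounded by summing the
    largest value over dyadic shells, and the area of the box is at least that of
    its lower half; the constant depends neither on the cone nor on the height. *)
Lemma integral_box_le phi : positive_on phi -> antitone_on phi -> measurable_profile phi ->
  dyadic_dominated (fun k => phi (dyad k)) ->
  exists2 K : R, (0 < K)%R & forall I H, arc I -> (0 < H <= 1)%R ->
    \int[area R]_(z in box I H) (phi (depth z))%:E
      <= (K * phi H)%:E * area R (box I H).
Proof.
move=> pos anti mphi [K K0 dom]; exists (4 * K)%R; first by rewrite mulr_gt0.
move=> I H aI /[dup] H01 /andP[H0 H1].
have [j /andP[jH Hj]] := dyad_bracket H01.
pose S k := shell I (dyad (j + k).+1) (dyad (j + k)).
have mS k : measurable (S k) by exact: measurable_shell.
have Sd k : S k `<=` @disc R by apply: shell_disc; rewrite ?dyad_le1 ?ltW ?dyad_gt0.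
have Ud : \bigcup_k S k `<=` @disc R by move=> z [k _] /Sd.
have phi0 z : disc z -> (0 <= (phi (depth z))%:E).
  by rewrite disc_depth lee_fin => /pos/ltW.
have mU : measurable (\bigcup_k S k) by exact: bigcup_measurable.
apply: (@le_trans _ _ (\int[area R]_(z in \bigcup_k S k) (phi (depth z))%:E)).
  apply: ge0_subset_integral => //.
  - exact: measurable_box.
  - exact: measurable_profileS.
  - by move=> z /Ud/phi0.
  - exact: box_sub_shells.
rewrite ge0_integral_bigcup//; last 3 first.
- exact: measurable_profileS.
- by move=> z /Ud/phi0.
- exact: shells_trivIset.
have term k : \int[area R]_(z in S k) (phi (depth z))%:E <=
    (aperture I * (dyad (j + k).+1 * phi (dyad (j + k).+1)))%:E.
  apply: le_trans (integral_le_const (M := phi (dyad (j + k).+1)) _ _ _ _ _) _ => //.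
    move=> z [_ /andP[kz zk]]; apply: anti; [exact: dyad_gt0|exact: ltW|].
    by rewrite (le_trans zk)// dyad_le1.
  by rewrite area_dyadic_shell// -EFinM lee_fin le_eqVlt; apply/orP; left; apply/eqP; ring.
apply: (@le_trans _ _ (aperture I * (K * (dyad j * phi (dyad j))))%:E).
  apply: lime_le.
    by apply: is_cvg_nneseries => k _ _; apply: integral_ge0 => z /Sd/phi0.
  apply: nearW => n; apply: le_trans (lee_sum _ (fun k _ => term k)) _.
  rewrite sumEFin lee_fin -mulr_sumr ler_wpM2l ?aperture_ge0//.
  apply: le_trans (dom j (j + n).+1).
  rewrite [leRHS]big_ltn ?ltnS ?leq_addr//.
  rewrite -[in leRHS](add0n j.+1) big_addn subSS addKn.
  rewrite [X in (_ <= _ + X)%R](eq_bigr (fun k =>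
    dyad (j + k).+1 * phi (dyad (j + k).+1)))%R; last first.
    by move=> k _; rewrite addnS addnC.
  by rewrite lerDr mulr_ge0// ltW// ?dyad_gt0// pos ?dyad_itv.
apply: le_trans (lee_wpmul2l _ (area_box_ge aI H01)); last first.
  by rewrite lee_fin !mulr_ge0// ltW// pos.
rewrite -EFinM lee_fin.
have -> : (4 * K * phi H * (H / 2 * aperture I) = aperture I * (K * ((2 * H) * phi H)))%R.
  by field.
rewrite ler_wpM2l ?aperture_ge0// ler_wpM2l ?(ltW K0)// ler_pM//.
- by rewrite ltW ?dyad_gt0.
- by rewrite ltW// pos ?dyad_itv.
- by move: jH; rewrite dyadS; lra.
- by apply: anti => //; rewrite dyad_le1.
Qed.

(** Each dyadic shell strictly below the top contributes at least its smallest
    value; the shell [k = j] is left out because its upper boundary is not in the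
    box. *)
Lemma integral_box_ge_sum phi I (j N : nat) : arc I -> positive_on phi -> antitone_on phi ->
  measurable_profile phi ->
  (aperture I * \sum_(j.+1 <= k < N) dyad k.+1 * phi (dyad k))%:E <=
  \int[area R]_(z in box I (dyad j)) (phi (depth z))%:E.
Proof.
move=> aI pos anti mphi.
pose S k := shell I (dyad k.+1) (dyad k).
have mS k : measurable (S k) by exact: measurable_shell.
have Sd k : S k `<=` @disc R by apply: shell_disc; rewrite ?dyad_le1 ?ltW ?dyad_gt0.
have phi0 z : disc z -> (0 <= (phi (depth z))%:E).
  by rewrite disc_depth lee_fin => /pos/ltW.
have US : \big[setU/set0]_(k <- index_iota j.+1 N) S k `<=` box I (dyad j).
  move=> z; rewrite -bigcup_seq => -[k /=]; rewrite mem_index_iota => /andP[jk _].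
  apply: shell_box; first by rewrite ltW ?dyad_gt0.
  apply: le_lt_trans (dyad_le jk) _; rewrite dyadS; have := dyad_gt0 j; lra.
have bd : box I (dyad j) `<=` @disc R by apply: box_disc; exact: dyad_itv.
have mU : measurable (\big[setU/set0]_(k <- index_iota j.+1 N) S k).
  by apply: bigsetU_measurable.
apply: (@le_trans _ _ (\int[area R]_(z in \big[setU/set0]_(k <- index_iota j.+1 N) S k)
    (phi (depth z))%:E)); last first.
  apply: ge0_subset_integral => //.
  - exact: measurable_box.
  - exact: measurable_profileS.
  - by move=> z /bd/phi0.
rewrite ge0_integral_bigsetU//; first last.
- by move=> z /US/bd/phi0.
- by apply: measurable_profileS => //; exact: subset_trans bd.
- by have := @shells_trivIset I 0; apply: sub_trivIset.
- exact: iota_uniq.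
rewrite mulr_sumr -sumEFin; apply: lee_sum => k _.
apply: le_trans (integral_ge_const (M := phi (dyad k)) _ _ _ _ _) => //.
- by rewrite area_dyadic_shell// -EFinM lee_fin le_eqVlt; apply/orP; left; apply/eqP; ring.
- by rewrite ltW// pos ?dyad_itv.
- move=> z [_ /andP[kz zk]]; apply: anti => //; last exact: dyad_le1.
  by apply: lt_trans kz; exact: dyad_gt0.
Qed.

(** A quarter of the box lying above depth [dyad j.+1], which stays away from the
    open upper boundary of the box. *)
Definition core_shell I (j : nat) := shell I (dyad j.+1) (3 / 2 * dyad j.+1).

Lemma area_core_shell I j : arc I -> area R (core_shell I j) = (dyad j / 4 * aperture I)%:E.
Proof.
move=> aI; have := dyad_gt0 j; have := dyad_le1 j => h1 h2.
by rewrite area_shell// dyadS; [congr (_ * _)%:E; lra|lra..].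
Qed.

Lemma core_shell_box I j : core_shell I j `<=` box I (dyad j).
Proof. by apply: shell_box; have := dyad_gt0 j; rewrite dyadS; lra. Qed.

Lemma integral_box_ge_core psi I (j : nat) : arc I -> positive_on psi -> monotone_on psi ->
  measurable_profile psi ->
  (psi (dyad j.+1) * (dyad j / 4 * aperture I))%:E <=
  \int[area R]_(z in box I (dyad j)) (psi (depth z))%:E.
Proof.
move=> aI pos mono mpsi.
have bd : box I (dyad j) `<=` @disc R by apply: box_disc; exact: dyad_itv.
have cd := subset_trans (@core_shell_box I j) bd.
have mc : measurable (core_shell I j) by exact: measurable_shell.
apply: (@le_trans _ _ (\int[area R]_(z in core_shell I j) (psi (depth z))%:E)); last first.
  apply: ge0_subset_integral => //.
  - exact: measurable_box.
  - exact: measurable_profileS.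
  - by move=> z /bd; rewrite disc_depth lee_fin => /pos/ltW.
  - exact: core_shell_box.
apply: le_trans (integral_ge_const (M := psi (dyad j.+1)) _ _ _ _ _) => //.
- by rewrite area_core_shell.
- by rewrite ltW// pos ?dyad_itv.
- move=> z /[dup] /cd; rewrite disc_depth => /andP[_ z1] [_ /andP[jz _]].
  by apply: mono => //; [exact: dyad_gt0|exact: ltW].
Qed.

End radial.

(** * Essential infima *)

Section essinf.
Context {R : realType}.
Implicit Types (z : plane R) (Q E : set (plane R)) (f : plane R -> \bar R).
Local Open Scope ereal_scope.

Lemma ess_inf_on_le Q E f (c : \bar R) : measurable E -> E `<=` Q ->
  0 < area R E -> (forall z, E z -> f z <= c) -> ess_inf_on Q f <= c.
Proof.
move=> mE EQ E0 fc; rewrite leNgt; apply/negP => cf.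
have := ess_inf_le (area R) (patch (cst +oo) Q f) => -[N [mN N0 sN]].
move: E0; apply/negP; rewrite -leNgt -[leRHS]N0; apply: le_measure; rewrite ?inE//.
move=> z Ez; apply: sN => /=; rewrite /patch mem_set; last exact: EQ.
by move=> h; move: cf; rewrite /ess_inf_on ltNge (le_trans h)// fc.
Qed.

Lemma ess_inf_on_ge Q f (c : \bar R) : (forall z, Q z -> c <= f z) ->
  c <= ess_inf_on Q f.
Proof.
move=> h; apply/ess_infP; apply: aeW => z; rewrite /patch.
by case: ifPn => [/set_mem/h//|_]; rewrite leey.
Qed.

End essinf.

(** * The full circle and integrability *)

Section full_circle.
Context {R : realType}.

Definition circle : set (plane R) := @expi R @` [set` `]-oo, +oo[].

Lemma arc_circle : arc circle.
Proof.
split; first by eexists.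
rewrite /arclen (_ : [set t | _] = `[0, 2 * pi[%classic); last first.
  apply/seteqP; split => t /=; rewrite in_itv/=; first by case.
  by move=> ->; split => //; exists t.
rewrite lebesgue_measure_itv/= lte_fin mulr_gt0 ?pi_gt0// -EFinB -EFinM lte_fin.
by rewrite subr0 mulVf// gt_eqF// mulr_gt0// pi_gt0.
Qed.

Lemma cone_circle : cone circle = ~` [set origin R].
Proof.
apply/seteqP; split => z; first by case.
by move=> z0; split => //; exists (carg z) => //; exact: expi_carg.
Qed.

Lemma aperture_circle_gt0 : 0 < aperture circle.
Proof.
have i01 : 0 < (1 : R) <= 1 by rewrite ltr01 lexx.
apply: lt_le_trans (aperture_gt0 i01) _; apply: aperture_le.
- exact: arc_itv.
- exact: arc_circle.
- by move=> _ [t _ <-]; exists t.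
Qed.

Lemma area_origin : area R [set origin R] = 0%E.
Proof.
rewrite /area/= /mscale/= set1_origin.
rewrite product_measure1E; [|exact: measurable_set1..].
by rewrite [X in (_ * (X * _))%E]lebesgue_measure_set1 mul0e mule0.
Qed.

(** The box of height 1 over the full circle is the punctured disc, and a point
    has no area. *)
Lemma integrable_radial (psi : R -> R) : measurable_profile psi -> positive_on psi ->
  (\int[area R]_(z in box circle 1) (psi (depth z))%:E < +oo)%E ->
  (area R).-integrable (@disc R) (fun z => (psi (depth z))%:E).
Proof.
move=> mpsi pos fin.
have md := @measurable_disc R.
have mpsi' := measurable_profileS mpsi (@subset_refl _ (@disc R)).
apply/integrableP; split => //.
have psi0 z : disc z -> (0 <= (psi (depth z))%:E)%E.
  by rewrite disc_depth lee_fin => /pos/ltW.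
rewrite (eq_integral (fun z => (psi (depth z))%:E)); last first.
  by move=> z /set_mem/psi0 h; rewrite gee0_abs.
rewrite (ge0_negligible_integral (N := [set origin R])) ?area_origin//; last first.
  exact: measurable_origin.
apply: le_lt_trans fin; rewrite le_eqVlt; apply/orP; left; apply/eqP.
congr (integral _ _ _); apply/seteqP; split => z.
  move=> [dz z0]; split; first by rewrite cone_circle.
  move: dz; rewrite disc_depth => /andP[-> _] /=.
  by rewrite /depth gtrBl exprn_gt0// cmod_gt0.
move=> [cz /andP[z0 z1]]; split; first by rewrite disc_depth z0 ltW.
by move: cz; rewrite cone_circle.
Qed.

Lemma integrable_eq_disc (f g : plane R -> \bar R) :
  (forall z, disc z -> f z = g z) ->
  (area R).-integrable (@disc R) g -> (area R).-integrable (@disc R) f.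
Proof.
move=> fg; apply: eq_integrable; first exact: measurable_disc.
by move=> z /set_mem dz; rewrite fg.
Qed.

End full_circle.

(** * Sufficient conditions for B_p *)

Section membership.
Context {R : realType}.
Implicit Types (psi phi : R -> R) (w : plane R -> \bar R).

Definition has_profile w psi : Prop :=
  forall z, disc z -> w z = (psi (depth z))%:E.

Lemma epow_EFin (x r : R) : 0 < x -> epow x%:E r = (x `^ r)%:E.
Proof.
move=> x0; rewrite /epow; case: ifPn => // _.
by rewrite inver gt_eqF// poweR_EFin -powR_inv1 ?ltW// -powRrM mulN1r opprK.
Qed.

Lemma has_profile_epow w psi r : has_profile w psi -> positive_on psi ->
  has_profile (fun z => epow (w z) r) (fun s => psi s `^ r).
Proof.
by move=> wE pos z dz; rewrite wE// epow_EFin// pos// -disc_depth.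
Qed.

Lemma weight_profile w psi : has_profile w psi -> positive_on psi ->
  measurable_profile psi -> weight w.
Proof.
move=> wE pos mpsi; split.
- apply: (eq_measurable_fun (fun z => (psi (depth z))%:E)).
    by move=> z /set_mem/wE.
  exact: measurable_profileS.
- by move=> z dz; rewrite wE// lee_fin ltW// pos// -disc_depth.
- by apply: aeW => z dz; rewrite wE// lte_fin ltry pos// -disc_depth.
Qed.

Lemma avg_eq (Q : set (plane R)) (f g : plane R -> \bar R) :
  (forall z, Q z -> f z = g z) -> avg Q f = avg Q g.
Proof.
by move=> fg; rewrite /avg (eq_integral g)// => z /set_mem/fg.
Qed.

Lemma avg_box_le w psi I H M : arc I -> 0 < H <= 1 -> 0 <= M ->
  has_profile w psi -> positive_on psi ->
  (\int[area R]_(z in box I H) (psi (depth z))%:E <= M%:E * area R (box I H))%E ->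
  (avg (box I H) w <= M%:E)%E.
Proof.
move=> aI H01 M0 wE pos h.
have bd := box_disc H01.
rewrite (avg_eq (g := fun z => (psi (depth z))%:E)); last by move=> z /(bd I)/wE.
apply: avg_le => //; first exact: area_box_fin.
by move=> z /(bd I); rewrite disc_depth lee_fin => /pos/ltW.
Qed.

Lemma positive_powR psi r : positive_on psi -> positive_on (fun s => psi s `^ r).
Proof. by move=> pos s s01; rewrite powR_gt0// pos. Qed.

Lemma powR_le_neg (x y r : R) : r <= 0 -> 0 < x -> x <= y -> y `^ r <= x `^ r.
Proof.
move=> r0 x0 xy; have y0 := lt_le_trans x0 xy.
rewrite -[r]opprK !(powRN _ (- r)) lef_pV2 ?posrE ?powR_gt0//.
by apply: ge0_ler_powR; rewrite ?oppr_ge0// nnegrE ltW.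
Qed.

Lemma integrable_has_profile w psi (M : R) : 0 <= M ->
  has_profile w psi -> positive_on psi -> measurable_profile psi ->
  (\int[area R]_(z in box circle 1) (psi (depth z))%:E
     <= M%:E * area R (box circle 1))%E ->
  (area R).-integrable (@disc R) w.
Proof.
move=> M0 wE pos mpsi h; apply: (integrable_eq_disc wE).
apply: integrable_radial => //; apply: le_lt_trans h _.
have i01 : 0 < (1 : R) <= 1 by rewrite ltr01 lexx.
rewrite -ge0_fin_numE; last by rewrite mule_ge0.
by rewrite fin_numM// ge0_fin_numE// area_box_fin//; exact: arc_circle.
Qed.

(** The two averages may be compared with the value of the weight at the height
    of the box: since (1 - p') * (p - 1) = -1, that value cancels from their
    product. *)
Lemma Bp_gt1_of_averages w psi p : 1 < p -> has_profile w psi -> positive_on psi ->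
  measurable_profile psi ->
  (exists2 C : R, 0 < C & forall I H, arc I -> 0 < H <= 1 ->
    (\int[area R]_(z in box I H) (psi (depth z))%:E
       <= (C * psi H)%:E * area R (box I H))%E /\
    (\int[area R]_(z in box I H) (psi (depth z) `^ (1 - conj_exp p))%:E
       <= (C * psi H `^ (1 - conj_exp p))%:E * area R (box I H))%E) ->
  Bp p w.
Proof.
move=> p1 wE pos mpsi [C C0 h]; right; split => //; split.
- exact: weight_profile mpsi.
- have i01 : 0 < (1 : R) <= 1 by rewrite ltr01 lexx.
  have [h1 _] := h _ _ (@arc_circle R) i01.
  by apply: (integrable_has_profile _ wE pos mpsi h1); rewrite ltW// mulr_gt0// pos.
exists (C * C `^ (p - 1)); first by rewrite mulr_gt0// powR_gt0.
move=> I aI; have [H H01 ->] := carleson_box aI.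
have [h1 h2] := h I H aI H01.
have pH := pos _ H01.
set r := 1 - conj_exp p in h h2 *.
have pE : (1 - conj_exp p) * (p - 1) = -1.
  by rewrite /conj_exp; field; lra.
have a1 : (avg (box I H) w <= (C * psi H)%:E)%E.
  by apply: (avg_box_le aI H01 _ wE) => //; rewrite ltW// mulr_gt0.
have a2 : (avg (box I H) (fun z => epow (w z) r) <= (C * psi H `^ r)%:E)%E.
  apply: (avg_box_le aI H01 _ (has_profile_epow r wE pos)) => //.
    by rewrite ltW// mulr_gt0// powR_gt0.
  exact: positive_powR.
have n2 : (0 <= avg (box I H) (fun z => epow (w z) r))%E.
  apply: avg_ge0 => z /(box_disc H01) dz.
  by rewrite (has_profile_epow r wE pos)// lee_fin powR_ge0.
apply: (@le_trans _ _ ((C * psi H)%:E * (poweR (C * psi H `^ r)%:E (p - 1)))%E).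
  apply: lee_pmul => //.
  - apply: avg_ge0 => z /(box_disc H01) dz.
    by rewrite wE// lee_fin ltW// pos// -disc_depth.
  - by rewrite /epow subr_ge0 (ltW p1) poweR_ge0.
  rewrite /epow subr_ge0 (ltW p1); apply: gt0_ler_poweR => //.
  - by rewrite subr_ge0 ltW.
  - by rewrite in_itv/= n2 leey.
  - by rewrite in_itv/= leey lee_fin ltW// mulr_gt0// powR_gt0.
rewrite poweR_EFin -EFinM lee_fin powRM ?powR_ge0 ?(ltW C0)//.
rewrite -powRrM pE powR_inv1 ?(ltW pH)//.
rewrite le_eqVlt; apply/orP; left; apply/eqP; field; by rewrite gt_eqF.
Qed.

(** For a weight growing towards the boundary circle the dyadic condition gives
    B_1, and the dual weight, which decays there, averages to at most its value at
    the height of the box. *)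
Lemma Bp_antitone w phi p : 1 <= p -> has_profile w phi -> positive_on phi ->
  antitone_on phi -> measurable_profile phi ->
  dyadic_dominated (fun k => phi (dyad k)) -> Bp p w.
Proof.
rewrite le_eqVlt => p1 wE pos anti mphi dom.
have [K K0 hK] := integral_box_le pos anti mphi dom.
have [pE|{}p1] := predU1P p1; last first.
  apply: (Bp_gt1_of_averages p1 wE pos mphi); exists (1 + K); first lra.
  move=> I H aI H01; have pH := pos _ H01; split.
    apply: le_trans (hK _ _ aI H01) _; apply: lee_wpmul2r => //.
    by rewrite lee_fin ler_pM2r//; lra.
  apply: (integral_le_const (psi := fun s => phi s `^ (1 - conj_exp p))) => //.
  - exact: measurable_box.
  - exact: box_disc.
  - exact: positive_powR.
  - exact: measurable_profile_powR.
  move=> z [_ /andP[z0 zH]].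
  have : phi (depth z) `^ (1 - conj_exp p) <= phi H `^ (1 - conj_exp p).
    apply: powR_le_neg => //; last by apply: anti => //; [exact: ltW|case/andP: H01].
    rewrite /conj_exp subr_le0 ler_pdivlMr ?subr_gt0//; lra.
  have : 0 < phi H `^ (1 - conj_exp p) by rewrite powR_gt0.
  by move: (_ `^ _) (_ `^ _) => x y; nra.
left; split; first by rewrite pE.
split.
- exact: weight_profile mphi.
- have i01 : 0 < (1 : R) <= 1 by rewrite ltr01 lexx.
  have h1 := hK _ _ (@arc_circle R) i01.
  by apply: (integrable_has_profile _ wE pos mphi h1); rewrite ltW// mulr_gt0// pos.
exists K => // I aI; have [H H01 ->] := carleson_box aI.
apply: (@le_trans _ _ (K * phi H)%:E).
  by apply: (avg_box_le aI H01 _ wE) => //; [rewrite ltW// mulr_gt0// pos|exact: hK].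
rewrite EFinM; apply: lee_wpmul2l; first by rewrite lee_fin ltW.
apply: ess_inf_on_ge => z bz; rewrite wE; last exact: box_disc bz.
case: bz => _ /andP[z0 zH].
by rewrite lee_fin; apply: anti => //; [exact: ltW|case/andP: H01].
Qed.

(** For a weight decaying towards the boundary circle the roles are exchanged:
    the dyadic condition concerns the dual weight. *)
Lemma Bp_monotone w psi p : 1 < p -> has_profile w psi -> positive_on psi ->
  monotone_on psi -> measurable_profile psi ->
  dyadic_dominated (fun k => psi (dyad k) `^ (1 - conj_exp p)) -> Bp p w.
Proof.
move=> p1 wE pos mono mpsi dom.
have r0 : 1 - conj_exp p <= 0.
  by rewrite /conj_exp subr_le0 ler_pdivlMr ?subr_gt0//; lra.
have anti : antitone_on (fun s => psi s `^ (1 - conj_exp p)).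
  move=> s t s0 st t1; apply: powR_le_neg => //; last exact: mono.
  by apply: pos; rewrite s0 (le_trans st).
have [K K0 hK] := integral_box_le (positive_powR _ pos) anti
  (measurable_profile_powR _ mpsi) dom.
apply: (Bp_gt1_of_averages p1 wE pos mpsi); exists (1 + K); first lra.
move=> I H aI H01; have pH := pos _ H01; split; last first.
  apply: le_trans (hK _ _ aI H01) _; apply: lee_wpmul2r => //.
  by rewrite lee_fin ler_pM2r ?powR_gt0//; lra.
apply: integral_le_const => //.
- exact: measurable_box.
- exact: box_disc.
move=> z [_ /andP[z0 zH]].
have : psi (depth z) <= psi H by apply: mono => //; [exact: ltW|case/andP: H01].
nra.
Qed.

Lemma B1_bounded w psi (c M : R) : has_profile w psi -> measurable_profile psi ->
  0 < c -> (forall s, 0 < s <= 1 -> c <= psi s <= M) -> Bp 1 w.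
Proof.
move=> wE mpsi c0 h.
have pos : positive_on psi by move=> s /h/andP[+ _]; exact: lt_le_trans.
have M0 : 0 < M.
  have i01 : 0 < (1 : R) <= 1 by rewrite ltr01 lexx.
  by have /andP[h1 h2] := h _ i01; lra.
have hM I H : arc I -> 0 < H <= 1 ->
    (\int[area R]_(z in box I H) (psi (depth z))%:E <= M%:E * area R (box I H))%E.
  move=> aI H01; apply: integral_le_const => //.
  - exact: measurable_box.
  - exact: box_disc.
  - by move=> z /(box_disc H01); rewrite disc_depth => /h/andP[].
left; split => //; split.
- exact: weight_profile mpsi.
- have i01 : 0 < (1 : R) <= 1 by rewrite ltr01 lexx.
  have h1 := hM _ _ (@arc_circle R) i01.
  exact: (integrable_has_profile (ltW M0) wE pos mpsi h1).
exists (M / c); first by rewrite divr_gt0.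
move=> I aI; have [H H01 ->] := carleson_box aI.
apply: (@le_trans _ _ M%:E).
  by apply: (avg_box_le aI H01 _ wE) => //; [exact: ltW|exact: hM].
have -> : M%:E = ((M / c)%:E * c%:E)%E by rewrite -EFinM divfK// gt_eqF.
apply: lee_wpmul2l.
  by rewrite lee_fin divr_ge0 ?ltW.
apply: ess_inf_on_ge => z /(box_disc H01) dz; rewrite wE//.
by move: dz; rewrite disc_depth lee_fin => /h/andP[].
Qed.

End membership.

(** * Necessary conditions from B_p *)

Section necessity.
Context {R : realType}.
Implicit Types (psi phi : R -> R) (w : plane R -> \bar R).

Lemma avg_box_ge w psi I j (c : R) : arc I -> 0 < aperture I -> 0 <= c ->
  has_profile w psi ->
  ((c * (dyad j * aperture I))%:E <=
    \int[area R]_(z in box I (dyad j)) (psi (depth z))%:E)%E ->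
  (c%:E <= avg (box I (dyad j)) w)%E.
Proof.
move=> aI k0 c0 wE h; have d01 := @dyad_itv R j.
rewrite (avg_eq (g := fun z => (psi (depth z))%:E)); last first.
  by move=> z /(box_disc d01)/wE.
apply: avg_ge h => //.
- by rewrite mulr_gt0// dyad_gt0.
- apply: lt_le_trans (area_box_ge aI d01).
  by rewrite lte_fin !mulr_gt0// dyad_gt0.
- exact: area_box_le.
Qed.

Lemma avg_box_ge_sum w phi I j N : arc I -> 0 < aperture I ->
  has_profile w phi -> positive_on phi -> antitone_on phi -> measurable_profile phi ->
  (((\sum_(j.+1 <= k < N) dyad k * phi (dyad k)) / (2 * dyad j))%:E <=
    avg (box I (dyad j)) w)%E.
Proof.
move=> aI k0 wE pos anti mphi; apply: (avg_box_ge aI k0 _ wE).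
  rewrite divr_ge0//; last by rewrite mulr_ge0// ltW// dyad_gt0.
  by apply: sumr_ge0 => k _; rewrite mulr_ge0// ltW// ?dyad_gt0// pos// dyad_itv.
apply: le_trans (integral_box_ge_sum j N aI pos anti mphi).
rewrite lee_fin le_eqVlt; apply/orP; left; apply/eqP.
under [in RHS]eq_bigr do rewrite dyadS mulrAC.
rewrite -mulr_suml; field; by rewrite gt_eqF// dyad_gt0.
Qed.

Lemma avg_box_ge_core w psi I j : arc I -> 0 < aperture I ->
  has_profile w psi -> positive_on psi -> monotone_on psi -> measurable_profile psi ->
  ((psi (dyad j.+1) / 4)%:E <= avg (box I (dyad j)) w)%E.
Proof.
move=> aI k0 wE pos mono mpsi; apply: (avg_box_ge aI k0 _ wE).
  by rewrite divr_ge0// ltW// pos// dyad_itv.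
apply: le_trans (integral_box_ge_core j aI pos mono mpsi).
by rewrite lee_fin le_eqVlt; apply/orP; left; apply/eqP; field.
Qed.

Lemma ess_inf_box_le w phi I j : arc I -> 0 < aperture I ->
  has_profile w phi -> antitone_on phi ->
  (ess_inf_on (box I (dyad j)) w <= (phi (dyad j.+1))%:E)%E.
Proof.
move=> aI k0 wE anti; apply: (ess_inf_on_le (E := core_shell I j)).
- exact: measurable_shell.
- exact: core_shell_box.
- by rewrite area_core_shell// lte_fin !mulr_gt0// dyad_gt0.
- move=> z cz; have dz : disc z := box_disc (@dyad_itv R j) (core_shell_box cz).
  rewrite wE// lee_fin; case: cz => _ /andP[jz _].
  apply: anti; [exact: dyad_gt0|exact: ltW|].
  by move: dz; rewrite disc_depth => /andP[].
Qed.

(** The left-hand side is the lower bound that [avg_box_ge_sum] provides for the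
    average over the box of height [dyad j]. *)
Lemma dyadic_dominated_of_averages (a : nat -> R) (C : R) : 0 < C ->
  (forall k, 0 < a k) ->
  (forall j N, (\sum_(j.+1 <= k < N) dyad k * a k) / (2 * dyad j) <= C * a j.+1) ->
  dyadic_dominated a.
Proof.
move=> C0 a0 h; apply: dyadic_dominated_shift => //; exists (2 * C).
  by rewrite mulr_gt0.
move=> j N; have := h j N; rewrite ler_pdivrMr ?mulr_gt0 ?dyad_gt0//.
move=> /le_trans; apply.
by rewrite -/(dyad j) le_eqVlt; apply/orP; left; apply/eqP; ring.
Qed.

Lemma epow_ge0 (x : \bar R) (r : R) : 0 <= r -> epow x r = poweR x r.
Proof. by rewrite /epow => ->. Qed.

Lemma poweR_homo (r : R) (x y : \bar R) : 0 <= r -> (0 <= x)%E -> (x <= y)%E ->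
  (poweR x r <= poweR y r)%E.
Proof.
by move=> r0 x0 xy; apply: gt0_ler_poweR => //; rewrite in_itv/= leey ?x0// (le_trans x0).
Qed.

Lemma conj_expE (p : R) : 1 < p -> 1 - conj_exp p = - (p - 1)^-1.
Proof. by move=> p1; rewrite /conj_exp; field; lra. Qed.

Lemma conj_exp_lt0 (p : R) : 1 < p -> 1 - conj_exp p < 0.
Proof. by move=> p1; rewrite conj_expE// oppr_lt0 invr_gt0 subr_gt0. Qed.

(** The average of the weight is at least a dyadic sum. The other factor (the
    average of the dual weight or, for p = 1, the essential infimum) is controlled
    by the value at half height, which is attained up to a constant on the core of
    the box. *)
Lemma dyadic_dominated_antitone w phi p : Bp p w -> has_profile w phi ->
  positive_on phi -> antitone_on phi -> measurable_profile phi ->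
  dyadic_dominated (fun k => phi (dyad k)).
Proof.
move=> [[_ [_ _ [C C0 hC]]]|[p1 [_ _ [C C0 hC]]]] wE pos anti mphi.
  apply: (dyadic_dominated_of_averages C0) => [k|j N]; first by rewrite pos ?dyad_itv.
  have [I [aI k0 IE]] := exists_arc_box (@dyad_itv R j).
  rewrite -lee_fin; apply: le_trans (avg_box_ge_sum j N aI k0 wE pos anti mphi) _.
  rewrite -IE; apply: le_trans (hC _ aI) _; rewrite EFinM; apply: lee_wpmul2l.
    by rewrite lee_fin ltW.
  by rewrite IE; exact: ess_inf_box_le.
have C4 : 0 < C * 4 `^ (p - 1) by rewrite mulr_gt0 ?powR_gt0.
apply: (dyadic_dominated_of_averages C4) => [k|j N]; first by rewrite pos ?dyad_itv.
have [I [aI k0 IE]] := exists_arc_box (@dyad_itv R j).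
set L := _ / _; set m := phi _.
have m0 : 0 < m by rewrite pos ?dyad_itv.
have r0 := conj_exp_lt0 p1.
have mono : monotone_on (fun s => phi s `^ (1 - conj_exp p)).
  move=> s t s0 st t1; apply: powR_le_neg; first exact: ltW.
    by rewrite pos// t1 (lt_le_trans s0).
  exact: anti.
have h1 : (L%:E <= avg (box I (dyad j)) w)%E by exact: avg_box_ge_sum mphi.
have h2 : ((m `^ (1 - conj_exp p) / 4)%:E <=
    avg (box I (dyad j)) (fun z => epow (w z) (1 - conj_exp p)))%E.
  exact: (avg_box_ge_core j aI k0 (has_profile_epow (1 - conj_exp p) wE pos)
    (positive_powR (1 - conj_exp p) pos) mono (measurable_profile_powR _ mphi)).
have p10 : 0 <= p - 1 by rewrite subr_ge0 ltW.
have L0 : 0 <= L.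
  rewrite divr_ge0//; last by rewrite mulr_ge0// ltW// dyad_gt0.
  by apply: sumr_ge0 => k _; rewrite mulr_ge0// ltW// ?dyad_gt0// pos// dyad_itv.
have v0 : 0 <= m `^ (1 - conj_exp p) / 4 by rewrite divr_ge0 ?powR_ge0.
have := hC I aI; rewrite IE (epow_ge0 _ p10) => h3.
have : ((L * (m `^ (1 - conj_exp p) / 4) `^ (p - 1))%:E <= C%:E)%E.
  apply: le_trans h3; rewrite EFinM -poweR_EFin.
  apply: lee_pmul; rewrite ?lee_fin ?poweR_ge0 ?powR_ge0//.
  by apply: poweR_homo; rewrite ?lee_fin.
rewrite lee_fin powRM ?powR_ge0// -powRrM conj_expE// mulNr mulVf; last by lra.
have -> : (4^-1 : R) `^ (p - 1) = (4 `^ (p - 1))^-1.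
  by rewrite -powR_inv1// -powRrM mulN1r powRN.
rewrite powR_inv1 ?(ltW m0)//.
rewrite mulrA ler_pdivrMr ?powR_gt0// ler_pdivrMr//.
Qed.

(** The same argument applied to the dual weight, which grows towards the boundary
    circle. *)
Lemma dyadic_dominated_monotone w psi p : 1 < p -> Bp p w -> has_profile w psi ->
  positive_on psi -> monotone_on psi -> measurable_profile psi ->
  dyadic_dominated (fun k => psi (dyad k) `^ (1 - conj_exp p)).
Proof.
move=> p1 [[pE _]|[_ [_ _ [C C0 hC]]]] wE pos mono mpsi.
  by rewrite pE ltxx in p1.
have C4 : 0 < (C * 4) `^ (p - 1)^-1 by rewrite powR_gt0// mulr_gt0.
apply: (dyadic_dominated_of_averages C4) => [k|j N].
  by rewrite powR_gt0// pos ?dyad_itv.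
have [I [aI k0 IE]] := exists_arc_box (@dyad_itv R j).
set L := _ / _; set m := psi _.
have m0 : 0 < m by rewrite pos ?dyad_itv.
have r0 := conj_exp_lt0 p1.
have anti : antitone_on (fun s => psi s `^ (1 - conj_exp p)).
  move=> s t s0 st t1; apply: powR_le_neg; first exact: ltW.
    by rewrite pos// s0 (le_trans st).
  exact: mono.
have h1 : (L%:E <= avg (box I (dyad j)) (fun z => epow (w z) (1 - conj_exp p)))%E.
  exact: (avg_box_ge_sum j N aI k0 (has_profile_epow (1 - conj_exp p) wE pos)
    (positive_powR (1 - conj_exp p) pos) anti (measurable_profile_powR _ mpsi)).
have h2 : ((m / 4)%:E <= avg (box I (dyad j)) w)%E by exact: avg_box_ge_core mpsi.
have p10 : 0 <= p - 1 by rewrite subr_ge0 ltW.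
have L0 : 0 <= L.
  rewrite divr_ge0//; last by rewrite mulr_ge0// ltW// dyad_gt0.
  by apply: sumr_ge0 => k _; rewrite mulr_ge0 ?powR_ge0// ltW// ?dyad_gt0.
have := hC I aI; rewrite IE (epow_ge0 _ p10) => h3.
have : ((m / 4 * L `^ (p - 1))%:E <= C%:E)%E.
  apply: le_trans h3; rewrite EFinM -poweR_EFin.
  apply: lee_pmul; rewrite ?lee_fin ?poweR_ge0 ?powR_ge0// ?divr_ge0 ?(ltW m0)//.
  by apply: poweR_homo; rewrite ?lee_fin.
have pV0 : 0 < (p - 1)^-1 by rewrite invr_gt0 subr_gt0.
rewrite lee_fin mulrC => h4; have {}h4 : L `^ (p - 1) <= C * 4 / m.
  by rewrite ler_pdivlMr//; move: h4; lra.
have -> : L = (L `^ (p - 1)) `^ (p - 1)^-1.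
  by rewrite -powRrM mulfV ?powRr1//; lra.
rewrite conj_expE//; have -> : m `^ (- (p - 1)^-1) = m^-1 `^ (p - 1)^-1.
  by rewrite -powR_inv1 ?(ltW m0)// -powRrM mulN1r.
rewrite -powRM ?invr_ge0 ?(ltW m0)//; last lra.
apply: ge0_ler_powR => //; first exact: ltW.
- by rewrite nnegrE powR_ge0.
- by rewrite nnegrE divr_ge0 ?(ltW m0)//; lra.
Qed.

(** The average over the whole disc is positive and is controlled by the essential
    infimum, which is below every value of a weight decaying towards the
    boundary circle. *)
Lemma B1_monotone_lower w psi : Bp 1 w -> has_profile w psi ->
  positive_on psi -> monotone_on psi -> measurable_profile psi ->
  exists2 c : R, 0 < c & forall s, 0 < s <= 1 -> c <= psi s.
Proof.
move=> [[_ [_ _ [C C0 hC]]]|[]]; last by rewrite ltxx.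
move=> wE pos mono mpsi.
have [I [aI k0 IE]] := exists_arc_box (@dyad_itv R 0).
have p1 : 0 < psi (dyad 1) by rewrite pos ?dyad_itv.
pose c := psi (dyad 1) / 4 / C.
have c0 : 0 < c by rewrite !divr_gt0.
have ce : (c%:E <= ess_inf_on (box I (dyad 0)) w)%E.
  rewrite -(@lee_pmul2l _ C%:E)// -EFinM /c mulrCA divff ?gt_eqF// mulr1.
  rewrite -IE; apply: le_trans (hC I aI); rewrite IE.
  exact: avg_box_ge_core mpsi.
have small s : 0 < s -> s < 1 -> c <= psi s.
  move=> s0 s1; rewrite -lee_fin; apply: le_trans ce _.
  apply: (ess_inf_on_le (E := shell I (s / 2) s)).
  - exact: measurable_shell.
  - by apply: shell_box; [rewrite divr_ge0 ?ltW|rewrite /dyad expr0 invr1].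
  - by rewrite area_shell//; [rewrite lte_fin mulr_gt0//; lra|lra..].
  move=> z sz; have dz : disc z by apply: (shell_disc _ _ sz); lra.
  rewrite wE// lee_fin; case: sz => _ /andP[sz zs].
  by apply: mono => //; [lra|exact: ltW].
exists c => // s /andP[s0 s1]; have := small (s / 2).
have : psi (s / 2) <= psi s by apply: mono => //; lra.
by move=> h1 h2; apply: le_trans h1; apply: h2; lra.
Qed.

End necessity.

(** * The profile of a monotonic weight *)

Section profile.
Context {R : realType}.
Implicit Types (w : plane R -> \bar R).

Lemma cmod_depth (z : plane R) : cmod z = Num.sqrt (1 - depth z).
Proof. by rewrite /depth opprB addrC subrK sqrtr_sqr ger0_norm// cmod_ge0. Qed.

Lemma cmod_origin : cmod (origin R) = 0.
Proof. by apply/eqP; rewrite cmod_eq0. Qed.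

(** Otherwise the property would fail on the annulus r <= |z| < 1, which has
    positive area. *)
Lemma ae_radial_point w (P : \bar R -> Prop) (f : R -> \bar R) r : 0 <= r < 1 ->
  (forall z, disc z -> w z = f (cmod z)) ->
  {ae area R, forall z, disc z -> P (w z)} ->
  exists2 t, r <= t < 1 & P (f t).
Proof.
move=> /andP[r0 r1] wE [N [mN N0 sN]]; apply: contrapT => nP.
pose S := shell circle 0 (1 - r ^+ 2).
have r2 : r ^+ 2 < 1 by rewrite expr_lt1.
have aC := @arc_circle R.
have : (area R S <= area R N)%E.
  apply: le_measure; rewrite ?inE//; first exact: measurable_shell.
  move=> z Sz; apply: sN => /= Pz; apply: nP.
  have dz : disc z by apply: (shell_disc _ _ Sz); have := sqr_ge0 r; lra.
  exists (cmod z); last by rewrite -wE//; exact: Pz.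
  case: Sz => _ /andP[_]; rewrite /depth lerD2l lerN2 => rz.
  by rewrite dz andbT -(@ler_pXn2r _ 2) ?nnegrE ?cmod_ge0.
rewrite [X in (_ <= X)%E]N0 area_shell//; [|lra|by have := sqr_ge0 r; lra].
rewrite lee_fin leNgt => /negP; apply; rewrite mulr_gt0 ?aperture_circle_gt0//; lra.
Qed.

(** Monotonicity upgrades almost everywhere positivity and finiteness to all of the
    disc: a value 0 or +oo would propagate either to the origin or to a whole
    annulus. An increasing function of |z| is a decreasing function of the depth. *)
Lemma monotonic_weight_profile w : monotonic_weight w ->
  (0 < w (origin R) < +oo)%E ->
  exists psi : R -> R, [/\ has_profile w psi, positive_on psi, measurable_profile psi
    & antitone_on psi \/ monotone_on psi].
Proof.
move=> [[mw w0 aew] [f [_ f0 wE] mon]] o01.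
have dz0 : disc (origin R) by rewrite /disc/= cmod_origin.
have fo : (0 < f 0%R < +oo)%E.
  by move: o01; rewrite (wE _ dz0) cmod_origin.
have i0 : (0 : R) \in `[0, 1[ by rewrite in_itv/= lexx ltr01.
have fin r : 0 <= r < 1 -> (0 < f r < +oo)%E.
  move=> /[dup] r01 /andP[r0 r1].
  have [t /andP[rt t1] /andP[ft0 ftoo]] :=
    ae_radial_point (P := fun x => is_true (0 < x < +oo)%E) (f := f) r01 wE aew.
  have ir : r \in `[0, 1[ by rewrite in_itv/= r0.
  have it : t \in `[0, 1[ by rewrite in_itv/= (le_trans r0).
  have /andP[fo0 fooo] := fo.
  case: mon => mon; apply/andP; split.
  - exact: lt_le_trans fo0 (mon _ _ i0 ir r0).
  - exact: le_lt_trans (mon _ _ ir it rt) ftoo.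
  - exact: lt_le_trans ft0 (mon _ _ ir it rt).
  - exact: le_lt_trans (mon _ _ i0 ir r0) fooo.
pose psi (s : R) := fine (f (Num.sqrt (1 - s))).
have sq (s : R) : 0 < s <= 1 -> 0 <= Num.sqrt (1 - s) < 1.
  move=> /andP[s0 s1]; rewrite sqrtr_ge0/= -[ltRHS]sqrtr1 ltr_sqrt//; lra.
have fE s : 0 < s <= 1 -> f (Num.sqrt (1 - s)) = (psi s)%:E.
  move=> /sq/fin/andP[h1 h2]; rewrite /psi fineK// ge0_fin_numE//; exact: ltW.
have prof : has_profile w psi.
  by move=> z dz; rewrite wE// cmod_depth fE// -disc_depth.
exists psi; split => //.
- by move=> s s01; rewrite -lte_fin -fE//; have /andP[] := fin _ (sq _ s01).
- apply/measurable_EFinP; apply: (eq_measurable_fun w) => // z /set_mem dz.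
  by rewrite prof.
- have le (s t : R) : 0 < s -> s <= t -> t <= 1 ->
      [/\ 0 < s <= 1, 0 < t <= 1, Num.sqrt (1 - s) \in `[0, 1[, Num.sqrt (1 - t) \in `[0, 1[
        & Num.sqrt (1 - t) <= Num.sqrt (1 - s)].
    move=> s0 st t1.
    have si : 0 < s <= 1 by rewrite s0 (le_trans st).
    have ti : 0 < t <= 1 by rewrite t1 (lt_le_trans s0).
    by split => //; rewrite ?in_itv/= ?sq// ler_wsqrtr//; lra.
  case: mon => mon; [left|right] => s t s0 st t1.
    by have [si ti ms mt lst] := le s t s0 st t1; rewrite -lee_fin -!fE//; exact: mon.
  by have [si ti ms mt lst] := le s t s0 st t1; rewrite -lee_fin -!fE//; exact: mon.
Qed.

End profile.

Local Close Scope classical_set_scope.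

Theorem corollary5p8 (R : realType) (w : plane R -> \bar R)
    (hw : monotonic_weight w)
    (hw0 : (0 < w (origin R) < +oo)%E) :
  (forall p : R, 1 < p -> Bp p w ->
     exists q : R, [/\ 1 < q, q < p & Bp q w]) /\
  (forall p : R, 1 <= p -> Bp p w ->
     exists2 eps : R, 0 < eps & Bp p (fun z => epow (w z) (1 + eps))).
Proof.
have [psi [wE pos mpsi mon]] := monotonic_weight_profile hw hw0.
have posd k : 0 < psi (dyad k) by rewrite pos ?dyad_itv.
have anti_pow r : 0 <= r -> antitone_on psi -> antitone_on (fun s => psi s `^ r).
  move=> r0 anti s t s0 st t1; apply: ge0_ler_powR => //; last exact: anti.
  - by rewrite nnegrE ltW// pos// t1 (lt_le_trans s0).
  - by rewrite nnegrE ltW// pos// s0 (le_trans st).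
have mono_pow r : 0 <= r -> monotone_on psi -> monotone_on (fun s => psi s `^ r).
  move=> r0 mono s t s0 st t1; apply: ge0_ler_powR => //; last exact: mono.
  - by rewrite nnegrE ltW// pos// s0 (le_trans st).
  - by rewrite nnegrE ltW// pos// t1 (lt_le_trans s0).
split=> p p1 Bw.
  case: mon => [anti|mono].
    have dom := dyadic_dominated_antitone Bw wE pos anti mpsi.
    exists ((1 + p) / 2); split; [lra|lra|].
    by apply: (Bp_antitone _ wE) => //; lra.
  have dom := dyadic_dominated_monotone p1 Bw wE pos mono mpsi.
  have [eps eps0 dome] := dyadic_dominated_powR (fun k => powR_gt0 _ (posd k)) dom.
  (* chosen so that 1 - q' = (1 - p') * (1 + eps) *)
  pose q := 1 + (p - 1) / (1 + eps).
  have q1 : 1 < q by rewrite /q ltrDl divr_gt0//; lra.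
  have qp : q < p.
    rewrite /q -ltrBrDl ltr_pdivrMr; nra.
  exists q; split => //; apply: (Bp_monotone q1 wE) => //.
  have -> : (fun k => psi (dyad k) `^ (1 - conj_exp q)) =
      (fun k => psi (dyad k) `^ (1 - conj_exp p) `^ (1 + eps)).
    apply/funext => k; rewrite -powRrM; congr (_ `^ _).
    by rewrite !conj_expE// /q [1 + _ - 1]addrAC subrr add0r invf_div mulrC mulNr.
  exact: dome.
case: mon => [anti|mono].
  have dom := dyadic_dominated_antitone Bw wE pos anti mpsi.
  have [eps eps0 dome] := dyadic_dominated_powR posd dom.
  have r0 : 0 <= 1 + eps by lra.
  exists eps; first exact: eps0.
  exact: (Bp_antitone p1 (has_profile_epow (1 + eps) wE pos)
    (positive_powR (1 + eps) pos) (anti_pow _ r0 anti)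
    (measurable_profile_powR (1 + eps) mpsi) dome).
move: p1; rewrite le_eqVlt => /predU1P[pE|p1].
  move: Bw; rewrite -pE => Bw.
  have [c c0 cpsi] := B1_monotone_lower Bw wE pos mono mpsi.
  have r0 : 0 <= 1 + 1 :> R by lra.
  have bounds s : 0 < s <= 1 -> c `^ (1 + 1) <= psi s `^ (1 + 1) <= psi 1 `^ (1 + 1).
    move=> /[dup] s01 /andP[s0 s1]; have cs := cpsi _ s01.
    have s1' : psi s <= psi 1 by exact: mono.
    have n0 : c \in Num.nneg by rewrite nnegrE ltW.
    have ns : psi s \in Num.nneg by rewrite nnegrE (le_trans (ltW c0)).
    have n1 : psi 1 \in Num.nneg by rewrite nnegrE (le_trans (ltW c0))// (le_trans cs).
    by rewrite (ge0_ler_powR r0 n0 ns cs) (ge0_ler_powR r0 ns n1 s1').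
  exists 1; first exact: ltr01.
  exact: (B1_bounded (has_profile_epow (1 + 1) wE pos)
    (measurable_profile_powR (1 + 1) mpsi) (powR_gt0 (1 + 1) c0) bounds).
have dom := dyadic_dominated_monotone p1 Bw wE pos mono mpsi.
have [eps eps0 dome] := dyadic_dominated_powR (fun k => powR_gt0 _ (posd k)) dom.
have r0 : 0 <= 1 + eps by lra.
exists eps; first exact: eps0.
apply: (Bp_monotone p1 (has_profile_epow (1 + eps) wE pos)
  (positive_powR (1 + eps) pos) (mono_pow _ r0 mono)
  (measurable_profile_powR (1 + eps) mpsi)).
have -> : (fun k => psi (dyad k) `^ (1 + eps) `^ (1 - conj_exp p)) =
    (fun k => psi (dyad k) `^ (1 - conj_exp p) `^ (1 + eps)).
  by apply/funext => k; rewrite powRAC.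
exact: dome.
Qed.
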